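(* Fix $s>0$ and $\alpha\ge1$. There exist a sequence of real potentials $V_q(t,x)$, a sequence of initial conditions $(u_0^q)$ and a sequence of times $T_q\to+\infty$ as $q\to+\infty$ such that: (1) the potentials are smooth in time, real analytic in space and uniformly bounded in Gevrey classes: there is a constant $C_\alpha$ such that for all $q$ and all $t\in[0,T_q]$, $\|V_q(t,\cdot)\|_{\mathcal{G}_\alpha}\le C_\alpha$; (2) $\|u_0^q\|_{H^s}=1$ for all $q$; (3) the corresponding solutions $u^q$ of the Cauchy problem $$i\partial_tu^q+\partial_x^2u^q+V_q(t,x)u^q=0,\qquad u^q(0,\cdot)=u_0^q,\qquad x\in\mathbb{S}^1,$$ are real analytic in space for $t\in[0,T_q]$; (4) there exists a constant $C_{\alpha,s}>0$ depending only on $\alpha$ and $s$ such that for all $q$ $$\|u^q(T_q)\|_{H^s}\ge C_{\alpha,s}(\ln T_q)^{s\alpha}.$$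
   Context: $\mathbb{S}^1=\mathbb{R}/2\pi\mathbb{Z}$ and $H^s=H^s(\mathbb{S}^1)$ is the usual Sobolev space. For $\alpha\ge1$, the Gevrey class $\mathcal{G}_\alpha(\mathbb{S}^1)$ is the set of $f\in\mathcal{C}^\infty(\mathbb{S}^1)$ such that for some $A,C>0$, $\sup_x|f^{(n)}(x)|\le CA^n(n!)^\alpha$ for all $n\in\mathbb{N}$; equivalently, for some $K>0$ and $B>0$, the Fourier coefficients satisfy $|\widehat f_j|\le Ke^{-B|j|^{1/\alpha}}$ for all $j\in\mathbb{Z}$. The semi-norm $\|f\|_{\mathcal{G}_\alpha}$ is the best constant $K$ in this last inequality; here $B>0$ is a fixed constant, independent of $q$ and $t$ (so the bound in (1) means that there are $B,C_\alpha>0$ with $|\widehat{V_q(t,\cdot)}_j|\le C_\alpha e^{-B|j|^{1/\alpha}}$ for all $q$, all $t\in[0,T_q]$ and all $j\in\mathbb{Z}$). The index $q$ of the sequences runs over (sufficiently large) positive integers. *)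

(* Defs.v *)
From Stdlib Require Import Reals ZArith.
From Coquelicot Require Import Coquelicot.
Open Scope R_scope.

(** Functions on the circle [R / 2 PI Z] are represented by 2 PI-periodic
    functions on [R]. *)
Definition periodic {E : Type} (f : R -> E) : Prop :=
  forall x : R, f (x + 2 * PI) = f x.

(** [expi y] is [e^(i y)]. *)
Definition expi (y : R) : C := (cos y, sin y).

Definition fourier_coeff (f : R -> C) (j : Z) : C :=
  (RtoC (/ (2 * PI)) *
   RInt (V := C_R_CompleteNormedModule)
     (fun x => f x * expi (- (IZR j * x)))%C 0 (2 * PI))%C.

(** [|j|^(1/alpha)].  The case split is needed because [Rpower 0 y = 1] in
    the standard library. *)
Definition gevrey_weight (alpha : R) (j : Z) : R :=
  if Z.eq_dec j 0 then 0 else Rpower (IZR (Z.abs j)) (/ alpha).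

(** Best constant [K] in [|f^_j| <= K e^(- B |j|^(1/alpha))]; it is [p_infty]
    when there is no such constant. *)
Definition gevrey_seminorm (alpha B : R) (f : R -> R) : Rbar :=
  Glb_Rbar (fun K => forall j : Z,
    Cmod (fourier_coeff (fun x => RtoC (f x)) j)
      <= K * exp (- B * gevrey_weight alpha j)).

(** Sums over [Z] of nonnegative terms: the indices [j >= 0] and [j < 0]. *)
Definition ex_zseries (a : Z -> R) : Prop :=
  ex_series (fun n : nat => a (Z.of_nat n)) /\
  ex_series (fun n : nat => a (- Z.of_nat (S n))%Z).

Definition zseries (a : Z -> R) : R :=
  Series (fun n : nat => a (Z.of_nat n)) +
  Series (fun n : nat => a (- Z.of_nat (S n))%Z).

Definition sobolev_term (s : R) (f : R -> C) (j : Z) : R :=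
  Rpower (1 + IZR j ^ 2) s * Cmod (fourier_coeff f j) ^ 2.

(** [H^s], restricted to Riemann integrable representatives.  The norm below is
    meaningful only for functions satisfying this predicate, since [Series]
    returns a default value on divergent series. *)
Definition in_Hs (s : R) (f : R -> C) : Prop :=
  periodic f /\
  ex_RInt (V := C_R_NormedModule) f 0 (2 * PI) /\
  ex_zseries (sobolev_term s f).

Definition Hs_norm (s : R) (f : R -> C) : R :=
  sqrt (zseries (sobolev_term s f)).

Definition real_analytic {E : NormedModule R_AbsRing} (f : R -> E) : Prop :=
  forall x0 : R, exists (a : nat -> E) (r : R), 0 < r /\
    forall x : R, Rabs (x - x0) < r -> is_pseries a (x - x0) (f x).

(** Smoothness of [t |-> V t] as a map with values in the continuous functions
    of [x]: all time derivatives exist and are jointly continuous. *)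
Definition smooth_in_time (V : R -> R -> R) : Prop :=
  forall n : nat,
    (forall t x : R, ex_derive_n (fun tau => V tau x) n t) /\
    (forall p : R * R,
       continuous (fun p : R * R =>
         Derive_n (fun tau => V tau (snd p)) n (fst p)) p).

(** Joint continuity on the closed strip [[0, T] x R]. *)
Definition continuous_on_strip (T : R) (w : R -> R -> C) : Prop :=
  forall t x : R, 0 <= t <= T ->
    filterlim (fun p : R * R => w (fst p) (snd p))
      (within (fun p : R * R => 0 <= fst p <= T) (locally (t, x)))
      (locally (w t x)).

(** Classical ([C^1] in time, [C^2] in space, up to the boundary) solutions on
    [[0, T]] of [i d_t u + d_x^2 u + V u = 0], [u(0, .) = u0].  The time
    derivative is required only in the interior; since [ut] is continuous up to
    the boundary, it is the one-sided derivative at the endpoints. *)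
Definition schrodinger_solution
    (V : R -> R -> R) (u0 : R -> C) (T : R) (u : R -> R -> C) : Prop :=
  (forall t : R, 0 <= t <= T -> periodic (u t)) /\
  (forall x : R, u 0 x = u0 x) /\
  continuous_on_strip T u /\
  exists ut ux uxx : R -> R -> C,
    continuous_on_strip T ut /\
    continuous_on_strip T ux /\
    continuous_on_strip T uxx /\
    (forall t x : R, 0 < t < T ->
       is_derive (K := R_AbsRing) (V := C_R_NormedModule)
         (fun tau => u tau x) t (ut t x)) /\
    (forall t x : R, 0 <= t <= T ->
       is_derive (K := R_AbsRing) (V := C_R_NormedModule) (u t) x (ux t x) /\
       is_derive (K := R_AbsRing) (V := C_R_NormedModule) (ux t) x (uxx t x) /\
       (Ci * ut t x + uxx t x + RtoC (V t x) * u t x = 0)%C).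

(* Main.v *)
Require Import Defs.
From Stdlib Require Import Reals ZArith Lra Lia Psatz FunctionalExtensionality.
From Coquelicot Require Import Coquelicot.
Open Scope R_scope.

(** A potential oscillating at frequency [q] in space can transfer mass from the
    mode [0] to the mode [q] if it also oscillates at frequency [q^2] in time, the
    difference of the eigenvalues of the two modes.  The Gevrey bound forces its
    amplitude to be of size [exp (- q^(1/alpha))], so the transfer takes a time [T]
    with [ln T] of order [q^(1/alpha)]; at its end the [H^s] norm is of order
    [q^s], that is [(ln T)^(s alpha)].

    With a pure cosine, the coupling to the other modes must be estimated.  This
    is avoided by a small correction which makes the problem exactly solvable.  Put
    [theta = q x - q^2 t] and
    [V = q^2 (2 b cos theta - b^2 sin^2 theta)]; in the moving frame this is the
    Whittaker-Hill (Razavy) potential, two of whose eigenfunctions are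
    elementary.  Inserting
    [u = exp (b cos theta) (A(t) + B(t) e^(i theta))] in the equation leaves
    [A' = i b q^2 B], [B' = i b q^2 A]; hence [A = cos (b q^2 t)],
    [B = i sin (b q^2 t)] is an exact solution ([solution_correct]), which goes
    from [exp (b cos theta)] to [i exp (b cos theta) e^(i theta)] in time
    [T = PI / (2 b q^2)].

    The correction adds the modes [0] and [2 q] to the potential, with amplitudes
    of order [q^2 b^2]; these satisfy the Gevrey bound because
    [(2 q)^(1/alpha) <= 2 q^(1/alpha)] ([potential_gevrey]).  For the Sobolev norms
    one needs the Fourier coefficients of [exp (b cos (q x + phi))].  The zero mode
    is at least [1] ([exp_cos_coeff_0_ge]), which gives the lower bound at time
    [T].  An integration by parts shows that the coefficients gain a factor [b q]
    each time the frequency increases by [q] ([exp_cos_coeff_le_pow]).  If [b] is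
    also smaller than a suitable power of [1 / q], which changes [ln T] only by
    [O(ln q)], the [H^s] norm of the initial datum is bounded uniformly in [q]
    before normalization ([exp_cos_Hs_norm_bounds]).

    The conclusions are about every classical solution, so the explicit one
    must be the only one: the [L^2] norm of the difference of two solutions is
    constant in time ([energy_uniqueness]).  Analyticity of [exp (b cos theta)] in
    [x] comes from a recursion for the power series of [exp o h]
    ([real_analytic_exp]). *)

(** * Complex-valued functions of a real variable *)

(* [ring] works only once the equation and its sums are stated in [C] itself. *)
Ltac ring_C :=
  cbv beta; match goal with |- @eq _ ?a ?b => change (@eq C a b) end;
  change (@plus _) with Cplus; ring.

Lemma is_derive_C_pair (f : R -> C) (x : R) (l : C) :
  is_derive (fun t => fst (f t)) x (fst l) ->
  is_derive (fun t => snd (f t)) x (snd l) ->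
  is_derive (K := R_AbsRing) (V := C_R_NormedModule) f x l.
Proof.
  intros H1 H2.
  unfold is_derive in *.
  apply (filterdiff_ext (fun t => (fst (f t), snd (f t)) : C_R_NormedModule)).
  { intros y; now destruct (f y). }
  apply (filterdiff_comp'_2 (K := R_AbsRing) (U := R_NormedModule) (V := R_NormedModule)
    (W := C_R_NormedModule)
    (fun t => fst (f t)) (fun t => snd (f t)) (fun a b => (a, b))
    x _ _ (fun a b => (a, b)) H1 H2).
  apply (filterdiff_ext (fun p => p)).
  { now intros [a b]. }
  apply (filterdiff_ext_lin _ (fun p => p)).
  { apply filterdiff_id. }
  now intros [a b].
Qed.

Lemma is_derive_C_fst (f : R -> C) (x : R) (l : C) :
  is_derive (K := R_AbsRing) (V := C_R_NormedModule) f x l ->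
  is_derive (fun t => fst (f t)) x (fst l).
Proof.
  intros H.
  apply (filterdiff_comp' (K := R_AbsRing) (V := C_R_NormedModule) f fst x
    (fun y => scal y l) fst H).
  apply filterdiff_linear, is_linear_fst.
Qed.

Lemma is_derive_C_snd (f : R -> C) (x : R) (l : C) :
  is_derive (K := R_AbsRing) (V := C_R_NormedModule) f x l ->
  is_derive (fun t => snd (f t)) x (snd l).
Proof.
  intros H.
  apply (filterdiff_comp' (K := R_AbsRing) (V := C_R_NormedModule) f snd x
    (fun y => scal y l) snd H).
  apply filterdiff_linear, is_linear_snd.
Qed.

Lemma continuous_C_pair {U : UniformSpace} (f : U -> C) (x : U) :
  continuous (fun t => fst (f t)) x -> continuous (fun t => snd (f t)) x ->
  continuous f x.
Proof.
  intros H1 H2.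
  apply (continuous_ext (fun t => (fst (f t), snd (f t)))).
  { intros t; now destruct (f t). }
  apply (continuous_comp_2 _ _ (fun a b => (a, b)) x H1 H2).
  apply (continuous_ext (fun p => p)).
  { now intros [a b]. }
  apply continuous_id.
Qed.

(** The integral is linear over [R] only, so complex scalars go through the
    components. *)
Lemma is_RInt_Cmult (c : C) (f : R -> C) (a b : R) (l : C) :
  is_RInt (V := C_R_NormedModule) f a b l ->
  is_RInt (V := C_R_NormedModule) (fun x => c * f x)%C a b (c * l)%C.
Proof.
  intros H.
  pose proof (is_RInt_fct_extend_fst (U := R_NormedModule) (V := R_NormedModule) f a b l H) as H1.
  pose proof (is_RInt_fct_extend_snd (U := R_NormedModule) (V := R_NormedModule) f a b l H) as H2.
  apply (is_RInt_fct_extend_pair (U := R_NormedModule) (V := R_NormedModule)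
     (fun x => c * f x)%C a b (fst (c * l)%C) (snd (c * l)%C)); simpl.
  - apply (is_RInt_minus (V := R_NormedModule)); apply (is_RInt_scal (V := R_NormedModule)); assumption.
  - apply (is_RInt_plus (V := R_NormedModule)); apply (is_RInt_scal (V := R_NormedModule)); assumption.
Qed.

(** * Fourier coefficients *)

(** Relational form of [fourier_coeff], which also records integrability. *)
Definition is_fourier_coeff (f : R -> C) (j : Z) (c : C) : Prop :=
  is_RInt (V := C_R_NormedModule)
    (fun x => f x * expi (- (IZR j * x)))%C 0 (2 * PI) (RtoC (2 * PI) * c)%C.

Lemma two_PI_neq_0 : RtoC (2 * PI) <> 0%C.
Proof.
  intros E; apply (f_equal fst) in E; simpl in E.
  pose proof PI_RGT_0; lra.
Qed.

Lemma is_fourier_coeff_unique f j c : is_fourier_coeff f j c -> fourier_coeff f j = c.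
Proof.
  intros H; unfold fourier_coeff.
  rewrite (is_RInt_unique (V := C_R_CompleteNormedModule) _ _ _ _ H).
  rewrite RtoC_inv by (pose proof PI_RGT_0; lra).
  field; apply two_PI_neq_0.
Qed.

Lemma continuous_expi (f : R -> R) x : continuous f x -> continuous (fun t => expi (f t)) x.
Proof.
  intros H; apply continuous_C_pair; simpl.
  - now apply continuous_cos_comp.
  - now apply continuous_sin_comp.
Qed.


Lemma continuous_C_fst {U : UniformSpace} (f : U -> C) (x : U) :
  continuous f x -> continuous (fun t => fst (f t)) x.
Proof.
  intros H; apply (continuous_comp f fst); [exact H|].
  destruct (f x) as [a b]; apply continuous_fst.
Qed.

Lemma continuous_C_snd {U : UniformSpace} (f : U -> C) (x : U) :
  continuous f x -> continuous (fun t => snd (f t)) x.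
Proof.
  intros H; apply (continuous_comp f snd); [exact H|].
  destruct (f x) as [a b]; apply continuous_snd.
Qed.

Lemma continuous_Cmult {U : UniformSpace} (f g : U -> C) (x : U) :
  continuous f x -> continuous g x -> continuous (fun t => f t * g t)%C x.
Proof.
  intros Hf Hg.
  pose proof (continuous_C_fst f x Hf); pose proof (continuous_C_snd f x Hf).
  pose proof (continuous_C_fst g x Hg); pose proof (continuous_C_snd g x Hg).
  apply continuous_C_pair; simpl.
  - apply (continuous_minus (V := R_NormedModule)); apply (continuous_mult (K := R_AbsRing)); assumption.
  - apply (continuous_plus (V := R_NormedModule)); apply (continuous_mult (K := R_AbsRing)); assumption.
Qed.

Lemma expi_add a b : expi (a + b) = (expi a * expi b)%C.
Proof.
  unfold expi, Cmult; simpl; rewrite cos_plus, sin_plus; f_equal; ring.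
Qed.

Lemma Cmod_expi y : Cmod (expi y) = 1.
Proof.
  unfold Cmod, expi; simpl.
  replace (cos y * (cos y * 1) + sin y * (sin y * 1)) with 1; [apply sqrt_1|].
  pose proof (sin2_cos2 y) as H; unfold Rsqr in H; lra.
Qed.

Lemma cos_IZR_period (k : Z) (x : R) : cos (x + 2 * PI * IZR k) = cos x.
Proof.
  destruct (Z_le_gt_dec 0 k) as [Hk | Hk].
  - rewrite <- (Z2Nat.id k Hk), <- INR_IZR_INZ.
    rewrite <- (cos_period x (Z.to_nat k)); f_equal; ring.
  - rewrite <- (cos_period (x + 2 * PI * IZR k) (Z.to_nat (- k))); f_equal.
    rewrite INR_IZR_INZ, Z2Nat.id, opp_IZR by lia; ring.
Qed.

Lemma sin_IZR_period (k : Z) (x : R) : sin (x + 2 * PI * IZR k) = sin x.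
Proof.
  pose proof (cos_IZR_period k (PI / 2 + (- (x + 2 * PI * IZR k)))) as H.
  rewrite <- !cos_shift.
  transitivity (cos (PI / 2 - (x + 2 * PI * IZR k) + 2 * PI * IZR k)).
  - symmetry; apply cos_IZR_period.
  - f_equal; ring.
Qed.

Lemma expi_IZR_period (k : Z) (x : R) : expi (x + 2 * PI * IZR k) = expi x.
Proof.
  unfold expi; now rewrite cos_IZR_period, sin_IZR_period.
Qed.

Lemma is_derive_expi (w phi x : R) :
  is_derive (K := R_AbsRing) (V := C_R_NormedModule)
    (fun t => expi (w * t + phi)) x (Ci * RtoC w * expi (w * x + phi))%C.
Proof.
  apply is_derive_C_pair; simpl; auto_derive; auto; ring.
Qed.

Lemma ex_fourier_coeff (f : R -> C) (j : Z) :
  (forall x, continuous f x) -> is_fourier_coeff f j (fourier_coeff f j).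
Proof.
  intros Hf.
  destruct (ex_RInt_continuous (V := C_R_CompleteNormedModule)
    (fun x => f x * expi (- (IZR j * x)))%C 0 (2 * PI)) as [I HI].
  { intros z _; apply continuous_Cmult; [apply Hf|].
    apply continuous_expi.
    apply (continuous_opp (V := R_NormedModule)).
    apply (continuous_mult (K := R_AbsRing)); [apply continuous_const | apply continuous_id]. }
  assert (E : is_fourier_coeff f j (/ RtoC (2 * PI) * I)%C).
  { unfold is_fourier_coeff.
    rewrite Cmult_assoc, Cinv_r, Cmult_1_l by apply two_PI_neq_0.
    exact HI. }
  now rewrite (is_fourier_coeff_unique _ _ _ E).
Qed.

Lemma is_fourier_coeff_ext f g j c :
  (forall x, f x = g x) -> is_fourier_coeff f j c -> is_fourier_coeff g j c.
Proof.
  intros E; apply is_RInt_ext; intros x _; now rewrite E.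
Qed.

Lemma is_fourier_coeff_plus f g j c d :
  is_fourier_coeff f j c -> is_fourier_coeff g j d ->
  is_fourier_coeff (fun x => f x + g x)%C j (c + d)%C.
Proof.
  intros Hf Hg; unfold is_fourier_coeff.
  replace (RtoC (2 * PI) * (c + d))%C
    with (plus (RtoC (2 * PI) * c)%C (RtoC (2 * PI) * d)%C)
    by (ring_C).
  eapply is_RInt_ext; [| apply (is_RInt_plus (V := C_R_NormedModule) _ _ _ _ _ _ Hf Hg)].
  intros x _; ring_C.
Qed.

Lemma is_fourier_coeff_Cmult a f j c :
  is_fourier_coeff f j c -> is_fourier_coeff (fun x => a * f x)%C j (a * c)%C.
Proof.
  intros Hf; unfold is_fourier_coeff.
  replace (RtoC (2 * PI) * (a * c))%C with (a * (RtoC (2 * PI) * c))%C by ring_C.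
  eapply is_RInt_ext; [| apply (is_RInt_Cmult a _ _ _ _ Hf)].
  intros x _; ring_C.
Qed.

Lemma is_fourier_coeff_shift f (k j : Z) c :
  is_fourier_coeff f (j - k) c ->
  is_fourier_coeff (fun x => expi (IZR k * x) * f x)%C j c.
Proof.
  apply is_RInt_ext; intros x _.
  replace (- (IZR (j - k) * x)) with (IZR k * x + - (IZR j * x))
    by (rewrite minus_IZR; ring).
  rewrite expi_add; ring_C.
Qed.

Lemma is_fourier_coeff_const j :
  is_fourier_coeff (fun _ => 1%C) j (if Z.eq_dec j 0 then 1%C else 0%C).
Proof.
  unfold is_fourier_coeff; destruct (Z.eq_dec j 0) as [-> | Hj].
  - apply (is_RInt_ext (V := C_R_NormedModule) (fun _ => RtoC 1)).
    { intros x _; rewrite Rmult_0_l, Ropp_0; unfold expi; rewrite cos_0, sin_0.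
      unfold Cmult; simpl; apply injective_projections; simpl; ring. }
    replace (RtoC (2 * PI) * 1)%C with (scal (V := C_R_NormedModule) (2 * PI - 0) (RtoC 1)).
    { apply (is_RInt_const (V := C_R_NormedModule)). }
    unfold scal; simpl; unfold prod_scal, scal; simpl; unfold mult; simpl.
    apply injective_projections; simpl; ring.
  - assert (Hj' : IZR j <> 0) by (now apply not_0_IZR).
    assert (H := is_RInt_derive (V := C_R_CompleteNormedModule)
      (fun x => expi (- IZR j * x + 0)) (fun x => Ci * RtoC (- IZR j) * expi (- IZR j * x + 0))%C
      0 (2 * PI) (fun x _ => is_derive_expi _ _ x)).
    match type of H with ?P -> _ => assert (HP : P) end.
    { intros x _; apply continuous_Cmult; [apply continuous_const|].
      apply (ex_derive_continuous (V := C_R_NormedModule) (fun x0 => expi (- IZR j * x0 + 0))).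
      eexists; apply is_derive_expi. }
    specialize (H HP).
    apply (is_RInt_Cmult (/ (Ci * RtoC (- IZR j)))) in H.
    assert (Hc : (Ci * RtoC (- IZR j))%C <> 0%C).
    { intros E; apply (f_equal snd) in E; simpl in E; lra. }
    replace (RtoC (2 * PI) * 0)%C with
      (/ (Ci * RtoC (- IZR j)) *
        @minus C_R_NormedModule (expi (- IZR j * (2 * PI) + 0)) (expi (- IZR j * 0 + 0)))%C.
    { eapply is_RInt_ext; [| exact H].
      intros x _; simpl. rewrite Cmult_assoc, Cinv_l, !Cmult_1_l by assumption. f_equal; ring. }
    replace (- IZR j * (2 * PI) + 0) with (- IZR j * 0 + 0 + 2 * PI * IZR (- j))
      by (rewrite opp_IZR; ring).
    rewrite expi_IZR_period.
    change (@minus C_R_NormedModule) with Cminus; ring.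
Qed.

Lemma is_fourier_coeff_expi (k j : Z) :
  is_fourier_coeff (fun x => expi (IZR k * x)) j (if Z.eq_dec j k then 1%C else 0%C).
Proof.
  apply (is_fourier_coeff_ext (fun x => expi (IZR k * x) * 1)%C).
  { intros x; ring. }
  apply is_fourier_coeff_shift.
  pose proof (is_fourier_coeff_const (j - k)) as H.
  destruct (Z.eq_dec (j - k) 0), (Z.eq_dec j k); try lia; exact H.
Qed.

Lemma fourier_coeff_le f j c M :
  (forall x, Cmod (f x) <= M) -> is_fourier_coeff f j c -> Cmod c <= M.
Proof.
  intros HM H; pose proof PI_RGT_0.
  assert (H1 : Cmod (RtoC (2 * PI) * c) <= (2 * PI - 0) * M).
  { rewrite Cmod_norm.
    apply (norm_RInt_le_const (V := C_R_NormedModule) (fun x => f x * expi (- (IZR j * x)))%C 0 (2 * PI)).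
    - lra.
    - intros x _; rewrite <- Cmod_norm, Cmod_mult, Cmod_expi, Rmult_1_r; apply HM.
    - exact H. }
  rewrite Cmod_mult, Cmod_R, Rabs_pos_eq in H1 by lra.
  apply (Rmult_le_reg_l (2 * PI)); lra.
Qed.

(** * Fourier coefficients of [exp (b cos (q x + phi))] *)

Definition exp_cos (b : R) (q : Z) (phi : R) (x : R) : C :=
  RtoC (exp (b * cos (IZR q * x + phi))).

Lemma continuous_exp_cos b q phi x : continuous (exp_cos b q phi) x.
Proof.
  apply continuous_C_pair; [|apply continuous_const]; simpl.
  apply (ex_derive_continuous (V := R_NormedModule)); auto_derive; auto.
Qed.

(** Integration by parts in [g' = - b q sin (q x + phi) g]: the boundary terms
    cancel by periodicity, and the two exponentials in the sine shift the
    frequency by [q] and by [- q]. *)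
Lemma exp_cos_coeff_rec b q phi (j : Z) :
  (RtoC (IZR j) * fourier_coeff (exp_cos b q phi) j =
   RtoC (b * IZR q / 2) *
     (expi phi * fourier_coeff (exp_cos b q phi) (j - q) -
      expi (- phi) * fourier_coeff (exp_cos b q phi) (j + q)))%C.
Proof.
  set (g := exp_cos b q phi).
  assert (Hg : forall k, is_fourier_coeff g k (fourier_coeff g k))
    by (intros k; apply ex_fourier_coeff; intros x; apply continuous_exp_cos).
  pose proof (Hg j) as H0.
  pose proof (is_fourier_coeff_shift g q j _ (Hg (j - q)%Z)) as H1.
  assert (H2 : is_fourier_coeff (fun x => expi (IZR (- q) * x) * g x)%C j (fourier_coeff g (j + q))).
  { apply is_fourier_coeff_shift; replace (j - - q)%Z with (j + q)%Z by lia; apply Hg. }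
  apply (is_fourier_coeff_Cmult (- (Ci * RtoC (IZR j)))) in H0.
  apply (is_fourier_coeff_Cmult (Ci * RtoC (b * IZR q / 2) * expi phi)) in H1.
  apply (is_fourier_coeff_Cmult (- (Ci * RtoC (b * IZR q / 2) * expi (- phi)))) in H2.
  pose proof (is_fourier_coeff_plus _ _ _ _ _ H0 (is_fourier_coeff_plus _ _ _ _ _ H1 H2)) as H.
  clear H0 H1 H2.
  set (G' := fun x : R => ((RtoC (- b * IZR q * sin (IZR q * x + phi)) + - (Ci * RtoC (IZR j)))
     * (g x * expi (- (IZR j * x))))%C).
  assert (HG : forall x : R, is_derive (K := R_AbsRing) (V := C_R_NormedModule)
     (fun x => g x * expi (- (IZR j * x)))%C x (G' x)).
  { intros x; unfold G', g, exp_cos, expi; apply is_derive_C_pair; simpl.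
    - auto_derive; auto; ring.
    - auto_derive; auto; ring. }
  assert (HI := is_RInt_derive (V := C_R_CompleteNormedModule) _ G' 0 (2 * PI) (fun x _ => HG x)).
  match type of HI with ?P -> _ => assert (HP : P) end.
  { intros x _; unfold G'; apply continuous_Cmult; [|apply continuous_Cmult].
    - apply continuous_C_pair; simpl;
      apply (ex_derive_continuous (V := R_NormedModule)); auto_derive; auto.
    - apply continuous_exp_cos.
    - apply continuous_C_pair; simpl;
      apply (ex_derive_continuous (V := R_NormedModule)); auto_derive; auto. }
  specialize (HI HP); clear HP.
  assert (Hper : (g (2 * PI)%R * expi (- (IZR j * (2 * PI))) = g 0%R * expi (- (IZR j * 0)))%C).
  { f_equal.
    - unfold g, exp_cos; do 3 f_equal.
      rewrite <- (cos_IZR_period q (IZR q * 0 + phi)); f_equal; ring.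
    - rewrite <- (expi_IZR_period (- j) (- (IZR j * 0))); f_equal; rewrite opp_IZR; ring. }
  cbv beta in HI; rewrite Hper in HI.
  assert (HF : is_fourier_coeff
     (fun x => (- (Ci * IZR j) * g x +
       (Ci * (b * IZR q / 2)%R * expi phi * (expi (IZR q * x) * g x) +
        - (Ci * (b * IZR q / 2)%R * expi (- phi)) * (expi (IZR (- q) * x) * g x)))%C) j 0%C).
  { unfold is_fourier_coeff.
    replace (RtoC (2 * PI) * 0)%C with
      (@minus C_R_NormedModule (g 0%R * expi (- (IZR j * 0)))%C (g 0%R * expi (- (IZR j * 0)))%C)
      by (change (@minus C_R_NormedModule) with Cminus; ring_C).
    eapply is_RInt_ext; [|exact HI].
    intros x _; unfold G'.
    transitivity ((- (Ci * IZR j) + Ci * (b * IZR q / 2)%R *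
        (expi (IZR q * x + phi) - expi (- (IZR q * x + phi)))) * (g x * expi (- (IZR j * x))))%C.
    - f_equal. unfold expi; rewrite cos_neg, sin_neg.
      apply injective_projections; simpl; field.
    - replace (- (IZR q * x + phi)) with (- phi + IZR (- q) * x) by (rewrite opp_IZR; ring).
      rewrite !expi_add; ring_C. }
  pose proof (is_fourier_coeff_unique _ _ _ H) as E1.
  pose proof (is_fourier_coeff_unique _ _ _ HF) as E2.
  assert (E0 := eq_trans (eq_sym E2) E1); clear E1 E2; rename E0 into E1.
  apply (f_equal (fun z => Ci * z)%C) in E1.
  set (c0 := fourier_coeff g j) in *. set (c1 := fourier_coeff g (j - q)) in *.
  set (c2 := fourier_coeff g (j + q)) in *.
  set (bq := RtoC (b * IZR q / 2)) in *.
  assert (Hi : (Ci * Ci = - (1))%C) by (apply injective_projections; simpl; ring).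
  replace (bq * (expi phi * c1 - expi (- phi) * c2))%C
    with (IZR j * c0 + (Ci * Ci + 1) * (bq * (expi phi * c1 - expi (- phi) * c2) - IZR j * c0)
       - Ci * (- (Ci * IZR j) * c0 + (Ci * bq * expi phi * c1 + - (Ci * bq * expi (- phi)) * c2)))%C
    by ring.
  rewrite <- E1, Hi; ring.
Qed.

Lemma exp_cos_coeff_le_step b q phi (j : Z) (M : R) : 0 <= b -> (0 < q)%Z -> j <> 0%Z ->
  Cmod (fourier_coeff (exp_cos b q phi) (j - q)) <= M ->
  Cmod (fourier_coeff (exp_cos b q phi) (j + q)) <= M ->
  Cmod (fourier_coeff (exp_cos b q phi) j) <= b * IZR q * M.
Proof.
  intros Hb Hq Hj H1 H2.
  pose proof (f_equal Cmod (exp_cos_coeff_rec b q phi j)) as E.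
  rewrite !Cmod_mult, !Cmod_R in E.
  assert (Hq' : 0 < IZR q) by (now apply IZR_lt).
  assert (Hj' : 1 <= Rabs (IZR j)).
  { rewrite <- abs_IZR; apply IZR_le; lia. }
  set (c0 := fourier_coeff _ j) in *. set (c1 := fourier_coeff _ (j - q)) in *.
  set (c2 := fourier_coeff _ (j + q)) in *.
  assert (Htri : Cmod (expi phi * c1 - expi (- phi) * c2) <= M + M).
  { eapply Rle_trans; [apply Cmod_triangle|].
    rewrite Cmod_opp, !Cmod_mult, !Cmod_expi; lra. }
  rewrite (Rabs_pos_eq (b * IZR q / 2)) in E by nra.
  pose proof (Cmod_ge_0 c0).
  assert (Rabs (IZR j) * Cmod c0 <= b * IZR q / 2 * (M + M)).
  { rewrite E; apply Rmult_le_compat_l; [nra|exact Htri]. }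
  nra.
Qed.

(** Iteration of the previous bound: each step costs [q] units of frequency and
    gains [b q], as long as the frequency stays away from [0]. *)
Lemma exp_cos_coeff_le_pow b q phi (m : nat) : 0 <= b -> (0 < q)%Z ->
  forall j : Z, ((Z.of_nat m - 1) * q < Z.abs j)%Z ->
  Cmod (fourier_coeff (exp_cos b q phi) j) <= exp b * (b * IZR q) ^ m.
Proof.
  intros Hb Hq; induction m as [|m IH]; intros j Hj.
  - rewrite pow_O, Rmult_1_r.
    apply (fourier_coeff_le (exp_cos b q phi) j).
    + intros x; unfold exp_cos; rewrite Cmod_R, Rabs_pos_eq by (left; apply exp_pos).
      destruct (COS_bound (IZR q * x + phi)) as [_ Hc].
      assert (b * cos (IZR q * x + phi) <= b) by nra.
      destruct H as [H | ->]; [left; now apply exp_increasing | lra].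
    + apply ex_fourier_coeff; intros x; apply continuous_exp_cos.
  - assert (Hj0 : j <> 0%Z) by nia.
    replace (exp b * (b * IZR q) ^ S m) with (b * IZR q * (exp b * (b * IZR q) ^ m)) by (simpl; ring).
    apply exp_cos_coeff_le_step; auto; apply IH; nia.
Qed.

(** The zero mode is the mean value; the mean of [b cos] vanishes and
    [1 + y <= exp y]. *)
Lemma exp_cos_coeff_0_ge b (q : Z) phi : q <> 0%Z ->
  1 <= Cmod (fourier_coeff (exp_cos b q phi) 0).
Proof.
  intros Hq; set (g := exp_cos b q phi).
  assert (Hg := ex_fourier_coeff g 0 (continuous_exp_cos b q phi)).
  assert (Hq' : IZR q <> 0) by (now apply not_0_IZR).
  apply (is_RInt_fct_extend_fst (U := R_NormedModule) (V := R_NormedModule)) in Hg.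
  assert (H1 : is_RInt (fun x => 1 + b * cos (IZR q * x + phi)) 0 (2 * PI) (2 * PI)).
  { replace (2 * PI) with
     (minus (2 * PI + b / IZR q * sin (IZR q * (2 * PI) + phi)) (0 + b / IZR q * sin (IZR q * 0 + phi))) at 2.
    - apply (is_RInt_derive (V := R_CompleteNormedModule) (fun x => x + b / IZR q * sin (IZR q * x + phi))).
      + intros x _; auto_derive; auto; field; auto.
      + intros x _; apply (ex_derive_continuous (V := R_NormedModule)); auto_derive; auto.
    - replace (IZR q * (2 * PI) + phi) with (IZR q * 0 + phi + 2 * PI * IZR q) by ring.
      rewrite sin_IZR_period; unfold minus, plus, opp; simpl; ring. }
  pose proof PI_RGT_0.
  assert (H2 : 2 * PI <= fst (RtoC (2 * PI) * fourier_coeff g 0)%C).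
  { apply (is_RInt_le _ _ 0 (2 * PI) _ _ ltac:(lra) H1 Hg).
    intros x _; unfold g, exp_cos, expi; simpl.
    rewrite Rmult_0_l, Ropp_0, cos_0, sin_0.
    pose proof (exp_ineq1_le (b * cos (IZR q * x + phi))); lra. }
  set (c0 := fourier_coeff g 0) in *; clearbody c0; simpl in H2.
  assert (1 <= fst c0) by (apply (Rmult_le_reg_l (2 * PI)); lra).
  pose proof (Rmax_Cmod c0) as H3.
  pose proof (Rmax_l (Rabs (fst c0)) (Rabs (snd c0))).
  pose proof (Rle_abs (fst c0)).
  lra.
Qed.

(** * Sobolev norms of functions with rapidly decaying coefficients *)

Lemma is_series_telescoping :
  is_series (fun n => / ((INR n + 1) * (INR n + 2))) 1.
Proof.
  change (is_lim_seq (sum_n (fun n => / ((INR n + 1) * (INR n + 2)))) 1).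
  apply (is_lim_seq_ext (fun n => 1 - / INR (S (S n)))).
  - intros n; induction n as [|n IH].
    + rewrite sum_O; simpl; field.
    + rewrite sum_Sn, <- IH; change (@plus _) with Rplus; rewrite !S_INR.
      pose proof (pos_INR n); field; lra.
  - assert (H : is_lim_seq (fun n => / INR (S (S n))) 0).
    { apply (is_lim_seq_inv _ p_infty); [|discriminate].
      apply (is_lim_seq_incr_1 (fun n => INR (S n))), (is_lim_seq_incr_1 INR), is_lim_seq_INR. }
    replace (Finite 1) with (Finite (1 - 0)) by (f_equal; ring).
    apply (is_lim_seq_minus' (fun _ => 1)); [apply is_lim_seq_const | exact H].
Qed.

Lemma term_le_Series (a : nat -> R) (m : nat) :
  (forall n, 0 <= a n) -> ex_series a -> a m <= Series a.
Proof.
  intros Ha [l Hl]; rewrite (is_series_unique _ _ Hl).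
  apply Rle_trans with (sum_n a m).
  - destruct m as [|m]; [rewrite sum_O; lra|].
    rewrite sum_Sn; unfold plus; simpl.
    enough (0 <= sum_n a m) by lra.
    rewrite sum_n_Reals; apply cond_pos_sum, Ha.
  - apply (is_lim_seq_incr_compare (sum_n a) l Hl).
    intros n; rewrite sum_Sn; unfold plus; simpl; specialize (Ha (S n)); lra.
Qed.

(** The constant [8] comes from [1 / (1 + n^2) <= 4 / ((n + 1) (n + 2))],
    used once on each half of [Z]. *)
Lemma zseries_le (a : Z -> R) (K : R) :
  (forall j, 0 <= a j <= K * / (1 + IZR j ^ 2)) ->
  ex_zseries a /\ zseries a <= 8 * K.
Proof.
  intros Ha.
  assert (HK : 0 <= K).
  { destruct (Ha 0%Z) as [H1 H2]. rewrite pow_i, Rplus_0_r, Rinv_1 in H2 by lia. lra. }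
  set (c := fun n => 4 * K * / ((INR n + 1) * (INR n + 2))).
  assert (Hc : is_series c (4 * K)).
  { replace (4 * K) with (scal (4 * K) 1) by (unfold scal; simpl; unfold mult; simpl; ring).
    apply (is_series_scal (K := R_AbsRing) (V := R_NormedModule) (4 * K) _ _ is_series_telescoping). }
  assert (Hb : forall (n : nat) (x : R), INR n ^ 2 <= x ^ 2 -> K * / (1 + x ^ 2) <= c n).
  { intros n x Hx; unfold c; rewrite (Rmult_comm 4 K), Rmult_assoc.
    apply Rmult_le_compat_l; [exact HK|].
    pose proof (pos_INR n) as Hn.
    apply (Rmult_le_reg_l (1 + x ^ 2)); [nra|].
    rewrite Rinv_r by nra.
    apply (Rmult_le_reg_r ((INR n + 1) * (INR n + 2))); [nra|].
    replace ((1 + x ^ 2) * (4 * / ((INR n + 1) * (INR n + 2))) * ((INR n + 1) * (INR n + 2)))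
      with (4 * (1 + x ^ 2)) by (field; nra).
    nra. }
  assert (H1 : forall n : nat, 0 <= a (Z.of_nat n) <= c n).
  { intros n; split; [apply Ha|].
    eapply Rle_trans; [apply Ha | apply Hb]; rewrite INR_IZR_INZ; lra. }
  assert (H2 : forall n : nat, 0 <= a (- Z.of_nat (S n))%Z <= c n).
  { intros n; split; [apply Ha|].
    eapply Rle_trans; [apply Ha | apply Hb].
    rewrite opp_IZR, <- INR_IZR_INZ, S_INR; pose proof (pos_INR n); nra. }
  assert (Hex : ex_series c) by (now exists (4 * K)).
  split; [split|].
  - apply (ex_series_le (K := R_AbsRing) (V := R_CompleteNormedModule) _ c); [|exact Hex].
    intros n; unfold norm; simpl; unfold abs; simpl; rewrite Rabs_pos_eq; apply H1.
  - apply (ex_series_le (K := R_AbsRing) (V := R_CompleteNormedModule) _ c); [|exact Hex].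
    intros n; unfold norm; simpl; unfold abs; simpl; rewrite Rabs_pos_eq; apply (H2 n).
  - unfold zseries.
    pose proof (Series_le _ c H1 Hex); pose proof (Series_le _ c H2 Hex).
    rewrite (is_series_unique _ _ Hc) in *; lra.
Qed.

Lemma sobolev_term_nonneg s f j : 0 <= sobolev_term s f j.
Proof.
  unfold sobolev_term; apply Rmult_le_pos; [left; apply exp_pos | apply pow2_ge_0].
Qed.

Lemma sobolev_term_le_zseries s f (n : nat) : ex_zseries (sobolev_term s f) ->
  sobolev_term s f (Z.of_nat n) <= zseries (sobolev_term s f).
Proof.
  intros [H1 H2]; unfold zseries.
  pose proof (term_le_Series (fun n => sobolev_term s f (Z.of_nat n)) n
    (fun n => sobolev_term_nonneg s f _) H1) as H3.
  pose proof (term_le_Series (fun n => sobolev_term s f (- Z.of_nat (S n))) 0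
    (fun n => sobolev_term_nonneg s f _) H2) as H4.
  pose proof (sobolev_term_nonneg s f (- Z.of_nat 1)); cbv beta in H3; lra.
Qed.

(** The hypothesis [s + 1 <= N] leaves a spare factor [1 / (1 + j^2)], which
    makes the Sobolev series converge. *)
Lemma sobolev_term_le (s : R) (N : nat) (K : R) (f : R -> C) (j : Z) :
  s + 1 <= INR N ->
  (1 + IZR j ^ 2) ^ N * Cmod (fourier_coeff f j) ^ 2 <= K ->
  sobolev_term s f j <= K * / (1 + IZR j ^ 2).
Proof.
  intros Hs HK; unfold sobolev_term.
  pose proof (pow2_ge_0 (IZR j)) as Hj; set (y := 1 + IZR j ^ 2) in *.
  apply (Rmult_le_reg_r y); [unfold y; lra|].
  rewrite Rmult_assoc, Rmult_assoc, Rinv_l, Rmult_1_r by (unfold y; lra).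
  refine (Rle_trans _ _ _ _ HK).
  rewrite (Rmult_comm _ y), <- Rmult_assoc.
  apply Rmult_le_compat_r; [apply pow2_ge_0|].
  rewrite <- (Rpower_1 y) at 2 by (unfold y; lra).
  rewrite <- Rpower_plus, <- Rpower_pow by (unfold y; lra).
  apply Rle_Rpower; [unfold y|]; lra.
Qed.

Lemma in_Hs_of_decay (s : R) (N : nat) (K : R) (f : R -> C) :
  s + 1 <= INR N -> periodic f -> (forall x, continuous f x) ->
  (forall j, (1 + IZR j ^ 2) ^ N * Cmod (fourier_coeff f j) ^ 2 <= K) ->
  in_Hs s f /\ zseries (sobolev_term s f) <= 8 * K.
Proof.
  intros Hs Hp Hc HK.
  destruct (zseries_le (sobolev_term s f) K) as [H1 H2].
  { intros j; split; [apply sobolev_term_nonneg | now apply sobolev_term_le with N]. }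
  split; [split; [exact Hp | split; [|exact H1]] | exact H2].
  apply (ex_RInt_continuous (V := C_R_CompleteNormedModule)); intros x _; apply Hc.
Qed.

Lemma exp_INR (n : nat) : exp (INR n) = exp 1 ^ n.
Proof.
  induction n as [|n IH]; [simpl; apply exp_0|].
  rewrite S_INR, exp_plus, IH; simpl; ring.
Qed.

(** If [b] beats a fixed power of [q], the gain of [b q] for each [q] units of
    frequency outweighs the Sobolev weight, uniformly in [q]: with
    [(m - 1) q < |j| <= m q] the weighted coefficient is at most
    [e (m q)^N (b q)^m <= e (m e^(-m))^N]. *)
Lemma exp_cos_decay b (q : Z) phi (N : nat) :
  0 <= b <= 1 -> (0 < q)%Z -> b * IZR q ^ S N <= exp (- INR N) -> forall j : Z,
  (1 + IZR j ^ 2) ^ N * Cmod (fourier_coeff (exp_cos b q phi) j) ^ 2 <= 2 ^ N * exp 1 ^ 2.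
Proof.
  intros [Hb0 Hb1] Hq HbN j.
  assert (Heb : exp b <= exp 1).
  { destruct Hb1 as [H | ->]; [left; now apply exp_increasing | lra]. }
  pose proof (exp_pos b) as Hebp.
  assert (Hq1 : 1 <= IZR q) by (apply IZR_le; lia).
  set (c := fourier_coeff (exp_cos b q phi) j).
  pose proof (Cmod_ge_0 c) as Hc0.
  destruct (Z.eq_dec j 0) as [-> | Hj].
  - assert (H := exp_cos_coeff_le_pow b q phi 0 Hb0 Hq 0 ltac:(lia)); fold c in H.
    simpl in H.
    rewrite pow_i, Rplus_0_r, pow1 by lia.
    assert (1 <= 2 ^ N) by (apply pow_R1_Rle; lra).
    apply Rmult_le_compat; try lra; [apply pow2_ge_0|].
    apply pow_incr; lra.
  - assert (Hm : exists m : nat, (1 <= m)%nat /\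
       ((Z.of_nat m - 1) * q < Z.abs j <= Z.of_nat m * q)%Z).
    { exists (Z.to_nat ((Z.abs j + q - 1) / q)).
      pose proof (Z.div_mod (Z.abs j + q - 1) q ltac:(lia)).
      pose proof (Z.mod_pos_bound (Z.abs j + q - 1) q Hq).
      assert (1 <= (Z.abs j + q - 1) / q)%Z by (apply Z.div_le_lower_bound; lia).
      rewrite Z2Nat.id by lia. split; [lia | nia]. }
    destruct Hm as [m [Hm1 [Hm2 Hm3]]].
    assert (H := exp_cos_coeff_le_pow b q phi m Hb0 Hq j Hm2); fold c in H.
    assert (HM : 1 <= INR m) by (apply (le_INR 1); lia).
    assert (HjM : Rabs (IZR j) <= INR m * IZR q).
    { rewrite <- abs_IZR, INR_IZR_INZ, <- mult_IZR; now apply IZR_le. }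
    assert (Hkey : Rabs (IZR j) ^ N * Cmod c <= exp 1).
    { apply Rle_trans with ((INR m * IZR q) ^ N * (exp 1 * (b * IZR q) ^ m)).
      { apply Rmult_le_compat; auto.
        - apply pow_le, Rabs_pos.
        - apply pow_incr; split; [apply Rabs_pos | exact HjM].
        - refine (Rle_trans _ _ _ H _).
          apply Rmult_le_compat_r; [apply pow_le; nra | exact Heb]. }
      assert (HqN : 1 <= IZR q ^ N) by (now apply pow_R1_Rle).
      apply Rle_trans with (INR m ^ N * (exp 1 * (IZR q ^ N * (b * IZR q)) ^ m)).
      { rewrite (Rpow_mult_distr (INR m)), (Rpow_mult_distr (IZR q ^ N)).
        assert (HqNm : IZR q ^ N <= (IZR q ^ N) ^ m).
        { rewrite <- (pow_1 (IZR q ^ N)) at 1; apply Rle_pow; auto. }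
        assert (0 <= INR m ^ N * exp 1 * (b * IZR q) ^ m).
        { repeat apply Rmult_le_pos; try (left; apply exp_pos); apply pow_le; nra. }
        nra. }
      apply Rle_trans with (INR m ^ N * (exp 1 * exp (- INR N) ^ m)).
      { apply Rmult_le_compat_l; [apply pow_le; lra|].
        apply Rmult_le_compat_l; [left; apply exp_pos|].
        apply pow_incr; split; [apply Rmult_le_pos; nra|].
        refine (Rle_trans _ _ _ (Req_le _ _ _) HbN); simpl; ring. }
      assert (Hmm : INR m ^ N <= exp (INR m) ^ N).
      { apply pow_incr; split; [lra|]. pose proof (exp_ineq1_le (INR m)); lra. }
      rewrite exp_Ropp, exp_INR, pow_inv, <- pow_mult, Nat.mul_comm, pow_mult, <- exp_INR.
      pose proof (exp_pos 1).
      assert (0 < exp (INR m) ^ N) by (apply pow_lt, exp_pos).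
      apply (Rmult_le_reg_r (exp (INR m) ^ N)); auto.
      rewrite !Rmult_assoc, Rinv_l, Rmult_1_r, Rmult_comm by lra.
      apply Rmult_le_compat_l; lra. }
    apply Rle_trans with ((2 * IZR j ^ 2) ^ N * Cmod c ^ 2).
    { apply Rmult_le_compat_r; [apply pow2_ge_0|].
      apply pow_incr.
      assert (1 <= IZR j ^ 2).
      { rewrite <- (pow1 2), <- (pow2_abs (IZR j)); apply pow_incr; split; [lra|].
        rewrite <- abs_IZR; apply IZR_le; lia. }
      lra. }
    rewrite Rpow_mult_distr, Rmult_assoc.
    apply Rmult_le_compat_l; [apply pow_le; lra|].
    rewrite <- (pow2_abs (IZR j)), <- pow_mult, Nat.mul_comm, pow_mult, <- Rpow_mult_distr.
    apply pow_incr; split; [|exact Hkey].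
    apply Rmult_le_pos; auto; apply pow_le, Rabs_pos.
Qed.

(** The bound is not uniform in [q]; it serves only to show that the final state
    belongs to [H^s]. *)
Lemma exp_cos_shift_decay b (q : Z) phi (N : nat) :
  0 <= b <= 1 -> (0 < q)%Z -> b * IZR q ^ S N <= exp (- INR N) -> forall j : Z,
  (1 + IZR j ^ 2) ^ N *
    Cmod (fourier_coeff (fun x => expi (IZR q * x) * exp_cos b q phi x)%C j) ^ 2 <=
  (2 * (1 + IZR q ^ 2)) ^ N * (2 ^ N * exp 1 ^ 2).
Proof.
  intros Hb Hq HbN j.
  rewrite (is_fourier_coeff_unique _ _ _ (is_fourier_coeff_shift _ q j _
    (ex_fourier_coeff _ _ (continuous_exp_cos b q phi)))).
  pose proof (exp_cos_decay b q phi N Hb Hq HbN (j - q)) as H.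
  eapply Rle_trans; [| apply Rmult_le_compat_l; [|exact H]].
  2: { apply pow_le; pose proof (pow2_ge_0 (IZR q)); lra. }
  rewrite <- Rmult_assoc, <- Rpow_mult_distr.
  apply Rmult_le_compat_r; [apply pow2_ge_0|].
  apply pow_incr; rewrite minus_IZR.
  pose proof (pow2_ge_0 (IZR j)).
  split; [lra|].
  (* Peetre's inequality [1 + j^2 <= 2 (1 + q^2) (1 + (j - q)^2)]; the difference of
     the two sides is [1] plus the first square twice and the second once. *)
  pose proof (pow2_ge_0 (IZR q * (IZR j - IZR q))).
  pose proof (pow2_ge_0 (IZR j - 2 * IZR q)).
  simpl in *; nra.
Qed.

(** * Real-analytic functions *)

Lemma Derive_n_cos_affine (a b : R) (n : nat) :
  Derive_n (fun t => cos (a * t + b)) n =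
  fun x => a ^ n * cos (a * x + b + INR n * (PI / 2)).
Proof.
  induction n as [|n IH]; apply functional_extensionality; intros x.
  - simpl; rewrite Rmult_1_l; f_equal; ring.
  - simpl Derive_n; rewrite IH.
    apply is_derive_unique.
    replace (a * x + b + INR (S n) * (PI / 2)) with (PI / 2 + (a * x + b + INR n * (PI / 2)))
      by (rewrite S_INR; field).
    rewrite <- (Ropp_involutive (cos (PI / 2 + _))), <- sin_cos.
    auto_derive; auto; simpl; ring.
Qed.

Lemma ex_derive_n_cos_affine (a b : R) (n : nat) (x : R) :
  ex_derive_n (fun t => cos (a * t + b)) n x.
Proof.
  destruct n as [|n]; simpl; auto.
  rewrite Derive_n_cos_affine; auto_derive; auto.
Qed.

(** Taylor's formula with remainder: every derivative of order [n + 1] is at most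
    [|a|^(n + 1)], so the remainder is at most [|a h|^(n + 1) / (n + 1)!]. *)
Lemma is_pseries_cos_pos (a b h : R) : 0 < h ->
  is_pseries (fun n => a ^ n * cos (b + INR n * (PI / 2)) / INR (fact n)) h (cos (a * h + b)).
Proof.
  intros Hh; apply is_pseries_R.
  set (c := fun n => a ^ n * cos (b + INR n * (PI / 2)) / INR (fact n) * h ^ n).
  change (is_lim_seq (sum_n c) (cos (a * h + b))).
  assert (HR : forall n, Rabs (sum_n c n - cos (a * h + b)) <= Rabs (a * h) ^ S n / INR (fact (S n))).
  { intros n.
    destruct (Taylor_Lagrange (fun t => cos (a * t + b)) n 0 h Hh) as [z [_ Hz]].
    { intros; apply ex_derive_n_cos_affine. }
    rewrite Hz, Rminus_0_r, sum_n_Reals.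
    rewrite (sum_eq c (fun m => h ^ m / INR (fact m) * Derive_n (fun t => cos (a * t + b)) m 0)).
    2: { intros i _; unfold c; rewrite Derive_n_cos_affine, Rmult_0_r, Rplus_0_l.
         field; apply INR_fact_neq_0. }
    rewrite Derive_n_cos_affine.
    match goal with |- Rabs (?u - (?u + ?v)) <= _ => replace (u - (u + v)) with (- v) by ring end.
    rewrite Rabs_Ropp.
    replace (h ^ S n / INR (fact (S n)) * (a ^ S n * cos (a * z + b + INR (S n) * (PI / 2))))
      with ((a * h) ^ S n / INR (fact (S n)) * cos (a * z + b + INR (S n) * (PI / 2)))
      by (rewrite Rpow_mult_distr; field; apply INR_fact_neq_0).
    assert (Hf : 0 < / INR (fact (S n))) by (apply Rinv_0_lt_compat, INR_fact_lt_0).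
    generalize (a * h); intros w; unfold Rdiv.
    rewrite !Rabs_mult, <- RPow_abs, (Rabs_pos_eq (/ _)) by lra.
    rewrite <- (Rmult_1_r (Rabs w ^ S n * / INR (fact (S n)))) at 2.
    apply Rmult_le_compat_l.
    - apply Rmult_le_pos; [apply pow_le, Rabs_pos | lra].
    - apply Rabs_le, COS_bound. }
  apply is_lim_seq_ext with (fun n => cos (a * h + b) + (sum_n c n - cos (a * h + b))).
  { intros n; ring. }
  rewrite <- (Rplus_0_r (cos (a * h + b))) at 1.
  apply (is_lim_seq_plus' (fun _ => cos (a * h + b))); [apply is_lim_seq_const|].
  apply is_lim_seq_abs_0.
  apply (is_lim_seq_le_le (fun _ => 0) _ (fun n => Rabs (a * h) ^ S n / INR (fact (S n)))).
  - intros n; split; [apply Rabs_pos | apply HR].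
  - apply is_lim_seq_const.
  - apply (is_lim_seq_incr_1 (fun n => Rabs (a * h) ^ n / INR (fact n))).
    apply is_lim_seq_Reals, cv_speed_pow_fact.
Qed.

Lemma is_pseries_cos (a b h : R) :
  is_pseries (fun n => a ^ n * cos (b + INR n * (PI / 2)) / INR (fact n)) h (cos (a * h + b)).
Proof.
  destruct (Rtotal_order h 0) as [Hh | [-> | Hh]].
  - (* The expansion was obtained to the right of the origin: reflect [h]. *)
    pose proof (is_pseries_cos_pos (- a) b (- h) ltac:(lra)) as H.
    apply is_pseries_R in H; apply is_pseries_R.
    replace (a * h + b) with (- a * - h + b) by ring.
    revert H; apply is_series_ext; intros n.
    replace (- a) with (-1 * a) by ring; replace (- h) with (-1 * h) by ring.
    rewrite !Rpow_mult_distr.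
    replace ((-1) ^ n * a ^ n * cos (b + INR n * (PI / 2)) / INR (fact n) * ((-1) ^ n * h ^ n))
      with ((-1) ^ n * (-1) ^ n * (a ^ n * cos (b + INR n * (PI / 2)) / INR (fact n) * h ^ n))
      by (field; apply INR_fact_neq_0).
    rewrite <- Rpow_mult_distr; replace (-1 * -1) with 1 by ring; rewrite pow1; apply Rmult_1_l.
  - pose proof (is_pseries_0 (K := R_AbsRing) (V := R_NormedModule) (fun n => a ^ n * cos (b + INR n * (PI / 2)) / INR (fact n))) as H.
    simpl in H; rewrite Rmult_0_r, Rplus_0_l.
    replace (cos b) with (1 * cos (b + 0 * (PI / 2)) / 1); [exact H|].
    rewrite Rmult_0_l, Rplus_0_r; field.
  - now apply is_pseries_cos_pos.
Qed.

Lemma real_analytic_cos (a b : R) :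
  real_analytic (E := R_NormedModule) (fun x => cos (a * x + b)).
Proof.
  intros x0; eexists; exists 1; split; [lra|]; intros x _.
  replace (a * x + b) with (a * (x - x0) + (a * x0 + b)) by ring.
  apply is_pseries_cos.
Qed.

Lemma real_analytic_ext {E : NormedModule R_AbsRing} (f g : R -> E) :
  (forall x, f x = g x) -> real_analytic f -> real_analytic g.
Proof.
  intros H; now replace g with f by (now apply functional_extensionality).
Qed.

Lemma CV_radius_ge (a : nat -> R) (f : R -> R) (r : R) :
  (forall y, Rabs y < r -> is_pseries a y (f y)) ->
  forall y, Rabs y < r -> Rbar_lt (Rabs y) (CV_radius a).
Proof.
  intros H y Hy.
  apply Rbar_lt_le_trans with ((Rabs y + r) / 2); [simpl; lra|].
  apply Rbar_not_lt_le; intros Hlt.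
  assert (Hz : Rabs ((Rabs y + r) / 2) = (Rabs y + r) / 2)
    by (apply Rabs_pos_eq; pose proof (Rabs_pos y); lra).
  rewrite <- Hz in Hlt; apply CV_disk_outside in Hlt; apply Hlt.
  apply ex_series_lim_0; exists (f ((Rabs y + r) / 2)).
  apply is_pseries_R, H; rewrite Hz; lra.
Qed.

Lemma real_analytic_mult (f g : R -> R) :
  real_analytic (E := R_NormedModule) f -> real_analytic (E := R_NormedModule) g ->
  real_analytic (E := R_NormedModule) (fun x => f x * g x).
Proof.
  intros Hf Hg x0.
  destruct (Hf x0) as [a [r [Hr Ha]]]; destruct (Hg x0) as [b [r' [Hr' Hb]]].
  assert (Ha' : forall y, Rabs y < Rmin r r' -> is_pseries (a : nat -> R) y (f (x0 + y))).
  { intros y Hy; pose proof (Rmin_l r r').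
    replace y with (x0 + y - x0) at 1 by ring; apply Ha.
    replace (x0 + y - x0) with y by ring; lra. }
  assert (Hb' : forall y, Rabs y < Rmin r r' -> is_pseries (b : nat -> R) y (g (x0 + y))).
  { intros y Hy; pose proof (Rmin_r r r').
    replace y with (x0 + y - x0) at 1 by ring; apply Hb.
    replace (x0 + y - x0) with y by ring; lra. }
  exists (PS_mult a b), (Rmin r r'); split; [now apply Rmin_pos|].
  intros x Hx; apply is_pseries_mult.
  - apply Ha; pose proof (Rmin_l r r'); lra.
  - apply Hb; pose proof (Rmin_r r r'); lra.
  - now apply (CV_radius_ge _ _ _ Ha').
  - now apply (CV_radius_ge _ _ _ Hb').
Qed.

Lemma real_analytic_plus (f g : R -> R) :
  real_analytic (E := R_NormedModule) f -> real_analytic (E := R_NormedModule) g ->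
  real_analytic (E := R_NormedModule) (fun x => f x + g x).
Proof.
  intros Hf Hg x0.
  destruct (Hf x0) as [a [r [Hr Ha]]]; destruct (Hg x0) as [b [r' [Hr' Hb]]].
  exists (PS_plus a b), (Rmin r r'); split; [now apply Rmin_pos|].
  intros x Hx; apply (is_pseries_plus a b).
  - apply Ha; pose proof (Rmin_l r r'); lra.
  - apply Hb; pose proof (Rmin_r r r'); lra.
Qed.

Lemma real_analytic_const (c : R) : real_analytic (E := R_NormedModule) (fun _ => c).
Proof.
  intros x0; exists (fun n => match n with O => c | _ => 0 end), 1; split; [lra|].
  intros x _; apply is_pseries_R.
  change (is_lim_seq (sum_n (fun n => (match n with O => c | _ => 0 end) * (x - x0) ^ n)) c).
  apply (is_lim_seq_ext (fun _ => c)); [|apply is_lim_seq_const].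
  intros n; induction n as [|n IH]; [rewrite sum_O; simpl; ring|].
  rewrite sum_Sn, <- IH; change (@plus _) with Rplus; ring.
Qed.

Lemma real_analytic_C (f : R -> C) :
  real_analytic (E := R_NormedModule) (fun x => fst (f x)) ->
  real_analytic (E := R_NormedModule) (fun x => snd (f x)) ->
  real_analytic (E := C_R_NormedModule) f.
Proof.
  intros Hf Hg x0.
  destruct (Hf x0) as [a [r [Hr Ha]]]; destruct (Hg x0) as [b [r' [Hr' Hb]]].
  exists (fun n => (a n, b n)), (Rmin r r'); split; [now apply Rmin_pos|].
  intros x Hx.
  assert (H1 := Ha x ltac:(pose proof (Rmin_l r r'); lra)).
  assert (H2 := Hb x ltac:(pose proof (Rmin_r r r'); lra)).
  unfold is_pseries, is_series in *.
  set (s1 := fun k => scal (pow_n (x - x0) k) (a k)) in *.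
  set (s2 := fun k => scal (pow_n (x - x0) k) (b k)) in *.
  replace (f x) with (fst (f x), snd (f x)) by (now destruct (f x)).
  apply (filterlim_ext (fun n => (sum_n s1 n, sum_n s2 n))).
  { intros n; induction n as [|n IH]; [now rewrite !sum_O|].
    rewrite !sum_Sn, <- IH; reflexivity. }
  intros P HP.
  destruct HP as [eps HP].
  assert (E1 := H1 (ball (fst (f x)) eps) (locally_ball _ eps)).
  assert (E2 := H2 (ball (snd (f x)) eps) (locally_ball _ eps)).
  unfold filtermap in *.
  generalize (filter_and (F := eventually) _ _ E1 E2); apply filter_imp.
  intros n [B1 B2]; apply HP; split; assumption.
Qed.

(** Power series of [exp h] from that [d] of [h']: the equation [y' = h' y]
    reads [(n + 1) y_(n+1) = sum_k d_k y_(n-k)].  [exp_coeffs d y0 n] is correct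
    up to rank [n]. *)
Fixpoint exp_coeffs (d : nat -> R) (y0 : R) (n : nat) : nat -> R :=
  match n with
  | O => fun _ => y0
  | S n' => fun k =>
      if Nat.leb k n' then exp_coeffs d y0 n' k
      else PS_mult d (exp_coeffs d y0 n') n' / INR (S n')
  end.

Definition exp_pseries (d : nat -> R) (y0 : R) (n : nat) : R := exp_coeffs d y0 n n.

Lemma exp_coeffs_stable d y0 n k : (k <= n)%nat -> exp_coeffs d y0 n k = exp_pseries d y0 k.
Proof.
  induction n as [|n IH]; intros Hk.
  - now replace k with 0%nat by lia.
  - destruct (Nat.eq_dec k (S n)) as [-> | Hne]; [reflexivity|].
    simpl; destruct (Nat.leb_spec k n); [apply IH; lia | lia].
Qed.

Lemma PS_derive_exp_pseries d y0 n :
  PS_derive (exp_pseries d y0) n = PS_mult d (exp_pseries d y0) n.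
Proof.
  unfold PS_derive, exp_pseries at 1.
  assert (E : exp_coeffs d y0 (S n) (S n) = PS_mult d (exp_coeffs d y0 n) n / INR (S n)).
  { change (exp_coeffs d y0 (S n) (S n)) with (if Nat.leb (S n) n then exp_coeffs d y0 n (S n)
      else PS_mult d (exp_coeffs d y0 n) n / INR (S n)).
    destruct (Nat.leb_spec (S n) n); [lia | reflexivity]. }
  rewrite E.
  replace (INR (S n) * (PS_mult d (exp_coeffs d y0 n) n / INR (S n)))
    with (PS_mult d (exp_coeffs d y0 n) n) by (field; apply not_0_INR; lia).
  apply sum_eq; intros i Hi; f_equal; apply exp_coeffs_stable; lia.
Qed.

(** The [n + 1] products [d_k y_(n-k)] are each at most [D |y0| L^n]; their number
    is compensated by the division by [n + 1]. *)
Lemma exp_pseries_bound d y0 D L :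
  0 < L -> D <= L -> (forall k, Rabs (d k) <= D * L ^ k) ->
  forall n, Rabs (exp_pseries d y0 n) <= Rabs y0 * L ^ n.
Proof.
  intros HL HDL Hd n.
  induction n as [n IH] using lt_wf_ind.
  destruct n as [|n]; [unfold exp_pseries; simpl; lra|].
  pose proof (PS_derive_exp_pseries d y0 n) as E.
  unfold PS_derive in E; set (y := exp_pseries d y0) in *.
  assert (Hn : 0 < INR (S n)) by (apply lt_0_INR; lia).
  apply (Rmult_le_reg_l (INR (S n))); auto.
  rewrite <- (Rabs_pos_eq (INR (S n))) at 1 by lra.
  rewrite <- Rabs_mult, E.
  eapply Rle_trans; [apply Rsum_abs|].
  apply Rle_trans with (sum_f_R0 (fun _ => D * Rabs y0 * L ^ n) n).
  - apply sum_Rle; intros k Hk.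
    rewrite Rabs_mult.
    replace (D * Rabs y0 * L ^ n) with ((D * L ^ k) * (Rabs y0 * L ^ (n - k))).
    + apply Rmult_le_compat; try apply Rabs_pos; [apply Hd | apply IH; lia].
    + replace (L ^ n) with (L ^ k * L ^ (n - k)) by (rewrite <- pow_add; f_equal; lia); ring.
  - rewrite sum_cte.
    rewrite <- tech_pow_Rmult.
    replace (D * Rabs y0 * L ^ n * INR (S n)) with (D * (INR (S n) * (Rabs y0 * L ^ n))) by ring.
    replace (INR (S n) * (Rabs y0 * (L * L ^ n))) with (L * (INR (S n) * (Rabs y0 * L ^ n))) by ring.
    apply Rmult_le_compat_r; [|exact HDL].
    repeat apply Rmult_le_pos; [lra | apply Rabs_pos | left; now apply pow_lt].
Qed.

(** The formal solution [a] of [y' = h' y] has a positive radius of convergence,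
    and its sum is [exp h] because [(sum a) exp (- h)] has derivative zero. *)
Lemma real_analytic_exp (h : R -> R) :
  real_analytic (E := R_NormedModule) h ->
  real_analytic (E := R_NormedModule) (fun x => exp (h x)).
Proof.
  intros Hh x0; destruct (Hh x0) as [b' [r [Hr Hb']]].
  set (b := b' : nat -> R).
  assert (Hb : forall y, Rabs y < r -> is_pseries b y (h (x0 + y))).
  { intros y Hy; replace y with (x0 + y - x0) at 1 by ring; apply Hb'.
    now replace (x0 + y - x0) with y by ring. }
  pose proof (CV_radius_ge _ _ _ Hb) as Hcv.
  set (d := PS_derive b).
  set (a := exp_pseries d (exp (b 0%nat))).
  assert (HL : exists D L, 0 < L /\ D <= L /\ forall k, Rabs (d k) <= D * L ^ k).
  { set (z := r / 2).
    assert (Hz : Rabs z < r) by (unfold z; rewrite Rabs_pos_eq; lra).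
    pose proof (ex_pseries_derive b z (Hcv z Hz)) as He.
    apply ex_pseries_R, ex_series_lim_0, is_lim_seq_Reals in He.
    destruct (maj_by_pos _ (exist _ 0 He)) as [D [HD1 HD2]].
    assert (Hz0 : 0 < / z) by (apply Rinv_0_lt_compat; unfold z; lra).
    exists D, (Rmax D (/ z)); split; [|split].
    - apply Rlt_le_trans with D; [lra | apply Rmax_l].
    - apply Rmax_l.
    - intros k; apply Rle_trans with (D * (/ z) ^ k).
      + specialize (HD2 k); rewrite Rabs_mult, <- RPow_abs, (Rabs_pos_eq z) in HD2
          by (unfold z; lra).
        apply (Rmult_le_reg_r (z ^ k)); [apply pow_lt; unfold z; lra|].
        rewrite Rmult_assoc, <- Rpow_mult_distr, Rinv_l, pow1, Rmult_1_r by (unfold z; lra).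
        exact HD2.
      + apply Rmult_le_compat_l; [lra|]; apply pow_incr; split; [lra | apply Rmax_r]. }
  destruct HL as [D [L [HL [HDL HdL]]]].
  pose proof (exp_pseries_bound d (exp (b 0%nat)) D L HL HDL HdL) as Hab; fold a in Hab.
  assert (Hca : Rbar_le (/ L) (CV_radius a)).
  { apply (proj1 (CV_radius_bounded a)); exists (Rabs (exp (b 0%nat))); intros n.
    rewrite Rabs_mult, <- RPow_abs.
    rewrite (Rabs_pos_eq (/ L)) by (left; now apply Rinv_0_lt_compat).
    apply (Rmult_le_reg_r (L ^ n)); [now apply pow_lt|].
    rewrite Rmult_assoc, <- Rpow_mult_distr, Rinv_l, pow1, Rmult_1_r by lra.
    apply Hab. }
  assert (HL' : 0 < / L) by (now apply Rinv_0_lt_compat).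
  exists a, (Rmin r (/ L)); split; [now apply Rmin_pos|].
  assert (Hra : forall y, Rabs y < Rmin r (/ L) -> Rbar_lt (Rabs y) (CV_radius a)).
  { intros y Hy; eapply Rbar_lt_le_trans; [|exact Hca]; simpl.
    eapply Rlt_le_trans; [exact Hy | apply Rmin_r]. }
  assert (Hrb : forall y, Rabs y < Rmin r (/ L) -> Rbar_lt (Rabs y) (CV_radius b)).
  { intros y Hy; apply Hcv; eapply Rlt_le_trans; [exact Hy | apply Rmin_l]. }
  assert (HD : forall y, Rabs y < Rmin r (/ L) ->
     is_derive (fun y => PSeries a y * exp (- PSeries b y)) y 0).
  { intros y Hy.
    pose proof (is_derive_PSeries a y (Hra y Hy)) as D1.
    pose proof (is_derive_PSeries b y (Hrb y Hy)) as D2.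
    rewrite (PSeries_ext (PS_derive a) (PS_mult d a) y (PS_derive_exp_pseries d _)) in D1.
    rewrite PSeries_mult in D1; [| unfold d; rewrite CV_radius_derive; auto | auto].
    fold d in D2.
    auto_derive.
    - split; [eexists; exact D1 | split; [eexists; exact D2 | auto]].
    - apply is_derive_unique in D1; apply is_derive_unique in D2.
      change (fun x : R => PSeries a x) with (PSeries a).
      change (fun x : R => PSeries b x) with (PSeries b).
      rewrite D1, D2; ring. }
  assert (H0 : Rabs 0 < Rmin r (/ L)) by (rewrite Rabs_R0; now apply Rmin_pos).
  assert (Hval : forall y, Rabs y < Rmin r (/ L) -> PSeries a y = exp (PSeries b y)).
  { intros y Hy.
    assert (E : PSeries a y * exp (- PSeries b y) = PSeries a 0 * exp (- PSeries b 0)).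
    { destruct (Rtotal_order y 0) as [Hlt | [-> | Hgt]]; [| reflexivity |].
      - apply (eq_is_derive (V := R_NormedModule) (fun y => PSeries a y * exp (- PSeries b y))); auto.
        intros t Ht; apply HD; rewrite Rabs_left1 in * by lra; lra.
      - symmetry; apply (eq_is_derive (V := R_NormedModule) (fun y => PSeries a y * exp (- PSeries b y))); auto.
        intros t Ht; apply HD; rewrite Rabs_pos_eq in * by lra; lra. }
    rewrite !PSeries_0 in E; change (a 0%nat) with (exp (b 0%nat)) in E.
    rewrite !exp_Ropp, Rinv_r in E by (apply Rgt_not_eq, exp_pos).
    pose proof (exp_pos (PSeries b y)).
    apply (Rmult_eq_reg_r (/ exp (PSeries b y))); [|apply Rinv_neq_0_compat; lra].
    rewrite E; field; lra. }
  intros x Hx.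
  replace (exp (h x)) with (PSeries a (x - x0)).
  - apply (PSeries_correct a), CV_radius_inside, Hra, Hx.
  - rewrite Hval by exact Hx; f_equal.
    apply is_pseries_unique; apply Hb'; eapply Rlt_le_trans; [exact Hx | apply Rmin_l].
Qed.

(** * Uniqueness of classical solutions *)

(** Clamping time to [[0, T]] extends a function continuous on the closed strip
    to a continuous function on the plane. *)
Definition clamp (T t : R) : R := Rmax 0 (Rmin t T).

Lemma clamp_id T t : 0 <= t <= T -> clamp T t = t.
Proof.
  intros H; unfold clamp; rewrite Rmin_left, Rmax_right; lra.
Qed.

Lemma clamp_bounds T t : 0 <= T -> 0 <= clamp T t <= T.
Proof.
  intros HT; unfold clamp, Rmax, Rmin; repeat destruct Rle_dec; lra.
Qed.

Lemma clamp_lipschitz T s t : Rabs (clamp T s - clamp T t) <= Rabs (s - t).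
Proof.
  unfold clamp, Rmax, Rmin, Rabs; repeat destruct Rle_dec; repeat destruct Rcase_abs; lra.
Qed.

Definition clamped_continuous {E : UniformSpace} (T : R) (f : R -> R -> E) : Prop :=
  forall p : R * R, continuous (fun p : R * R => f (clamp T (fst p)) (snd p)) p.

Lemma continuous_on_strip_clamped T (w : R -> R -> C) : 0 <= T ->
  continuous_on_strip T w -> clamped_continuous (E := C_UniformSpace) T w.
Proof.
  intros HT Hw [t x].
  specialize (Hw (clamp T t) x (clamp_bounds T t HT)).
  intros P HP; specialize (Hw P HP).
  destruct Hw as [eps Heps]; exists eps; intros [t' x'] [H1 H2]; simpl in *.
  apply (Heps (clamp T t', x')).
  - split; [|exact H2].
    unfold ball in *; simpl in *; unfold AbsRing_ball, abs, minus, plus, opp in *; simpl in *.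
    eapply Rle_lt_trans; [apply clamp_lipschitz | exact H1].
  - now apply clamp_bounds.
Qed.

Lemma clamped_continuous_2d T (f : R -> R -> R) t x :
  clamped_continuous T f -> continuity_2d_pt (fun u v => f (clamp T u) v) t x.
Proof.
  intros H; apply continuity_2d_pt_filterlim, (H (t, x)).
Qed.

Lemma clamped_continuous_slice T (f : R -> R -> R) t : 0 <= t <= T ->
  clamped_continuous T f -> forall x, continuous (f t) x.
Proof.
  intros Ht H x.
  apply (continuous_ext (fun x => f (clamp T t) x)).
  { intros y; now rewrite clamp_id. }
  apply (continuous_comp_2 (fun _ => t) (fun x => x) (fun a b => f (clamp T a) b)).
  - apply continuous_const.
  - apply continuous_id.
  - apply (H (t, x)).
Qed.

Lemma RInt_zero_nonneg (f : R -> R) (a b x : R) :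
  (forall y, continuous f y) -> (forall y, 0 <= f y) -> a < x < b ->
  RInt f a b = 0 -> f x = 0.
Proof.
  intros Hc Hf Hx H0.
  destruct (Hf x) as [Hpos | <-]; [exfalso | reflexivity].
  assert (Hex : forall c d, ex_RInt f c d)
    by (intros c d; apply (ex_RInt_continuous (V := R_CompleteNormedModule)); auto).
  assert (Hhalf : 0 < f x / 2) by lra.
  destruct (Hc x (ball (f x) (mkposreal _ Hhalf)) (locally_ball _ _)) as [dlt Hd].
  set (e := Rmin (dlt / 2) (Rmin (x - a) (b - x))).
  assert (He : 0 < e).
  { unfold e; repeat apply Rmin_pos; try lra; destruct dlt; simpl; lra. }
  assert (He1 : e <= dlt / 2) by apply Rmin_l.
  assert (He2 : e <= Rmin (x - a) (b - x)) by apply Rmin_r.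
  pose proof (Rmin_l (x - a) (b - x)); pose proof (Rmin_r (x - a) (b - x)).
  assert (Hlow : (x + e - (x - e)) * (f x / 2) <= RInt f (x - e) (x + e)).
  { replace ((x + e - (x - e)) * (f x / 2)) with (RInt (fun _ => f x / 2) (x - e) (x + e)).
    - apply RInt_le; auto; [lra | apply ex_RInt_const |].
      intros y Hy.
      assert (Hb : ball (f x) (f x / 2) (f y)).
      { apply Hd; unfold ball; simpl; unfold AbsRing_ball, abs, minus, plus, opp; simpl.
        apply Rabs_def1; destruct dlt; simpl in *; lra. }
      unfold ball in Hb; simpl in Hb; unfold AbsRing_ball, abs, minus, plus, opp in Hb; simpl in Hb.
      apply Rabs_def2 in Hb; lra.
    - rewrite RInt_const; unfold scal; simpl; unfold mult; simpl; ring. }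
  assert (Hl : 0 <= RInt f a (x - e)) by (apply RInt_ge_0; auto; lra).
  assert (Hr : 0 <= RInt f (x + e) b) by (apply RInt_ge_0; auto; lra).
  rewrite <- (RInt_Chasles f a (x - e) b (Hex _ _) (Hex _ _)) in H0.
  rewrite <- (RInt_Chasles f (x - e) (x + e) b (Hex _ _) (Hex _ _)) in H0.
  change (@plus _) with Rplus in H0; nra.
Qed.

Lemma is_derive_periodic (f g : R -> R) (c : R) :
  (forall x, f (x + c) = f x) -> (forall x, is_derive f x (g x)) ->
  forall x, g (x + c) = g x.
Proof.
  intros Hp Hd x.
  rewrite <- (is_derive_unique _ _ _ (Hd x)).
  symmetry; apply is_derive_unique.
  apply (is_derive_ext (fun y => f (y + c))); [exact Hp|].
  replace (g (x + c)) with (scal 1 (g (x + c))) by (unfold scal; simpl; unfold mult; simpl; ring).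
  apply (is_derive_comp f (fun y => y + c) x); [apply Hd|].
  auto_derive; auto; ring.
Qed.

(** Conservation of the energy [int (p^2 + q^2)] over a period: its density
    satisfies [(p^2 + q^2)_t = 2 (q p_x - p q_x)_x], whose right-hand side has
    integral zero by periodicity.  Integrating over [[y, y + 2 PI]] for arbitrary
    [y] makes every point interior. *)
Lemma energy_uniqueness (T : R) (p q pt qt px qx pxx qxx : R -> R -> R) :
  0 < T ->
  clamped_continuous T p -> clamped_continuous T q ->
  clamped_continuous T pt -> clamped_continuous T qt ->
  clamped_continuous T pxx -> clamped_continuous T qxx ->
  (forall t x, 0 <= t <= T -> p t (x + 2 * PI) = p t x) ->
  (forall t x, 0 <= t <= T -> q t (x + 2 * PI) = q t x) ->
  (forall t x, 0 < t < T -> is_derive (fun s => p s x) t (pt t x)) ->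
  (forall t x, 0 < t < T -> is_derive (fun s => q s x) t (qt t x)) ->
  (forall t x, 0 <= t <= T -> is_derive (p t) x (px t x)) ->
  (forall t x, 0 <= t <= T -> is_derive (q t) x (qx t x)) ->
  (forall t x, 0 <= t <= T -> is_derive (px t) x (pxx t x)) ->
  (forall t x, 0 <= t <= T -> is_derive (qx t) x (qxx t x)) ->
  (forall t x, 0 <= t <= T -> p t x * pt t x + q t x * qt t x = q t x * pxx t x - p t x * qxx t x) ->
  (forall x, p 0 x = 0) -> (forall x, q 0 x = 0) ->
  forall t x, 0 <= t <= T -> p t x = 0 /\ q t x = 0.
Proof.
  intros HT Cp Cq Cpt Cqt Cpxx Cqxx Pp Pq Dpt Dqt Dpx Dqx Dpxx Dqxx Heq p0 q0.
  set (G := fun t x => p t x * p t x + q t x * q t x).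
  assert (Cplus : forall f g, clamped_continuous T f -> clamped_continuous T g ->
    clamped_continuous T (fun t x => f t x + g t x)).
  { intros f g Hf Hg z; apply (continuous_plus (V := R_NormedModule)); [apply Hf | apply Hg]. }
  assert (Cmult : forall f g, clamped_continuous T f -> clamped_continuous T g ->
    clamped_continuous T (fun t x => f t x * g t x)).
  { intros f g Hf Hg z; apply (continuous_mult (K := R_AbsRing)); [apply Hf | apply Hg]. }
  assert (CG : clamped_continuous T G) by (unfold G; auto).
  set (Gt := fun t x => 2 * (p t x * pt t x + q t x * qt t x)).
  assert (CGt : clamped_continuous T Gt).
  { unfold Gt; apply (Cmult (fun _ _ => 2)); auto; intros z; apply continuous_const. }
  assert (DG : forall t x, 0 < t < T -> is_derive (fun s => G s x) t (Gt t x)).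
  { intros t x Ht; unfold G, Gt.
    pose proof (Dpt t x Ht) as D1; pose proof (Dqt t x Ht) as D2.
    pose proof (is_derive_plus _ _ _ _ _ (is_derive_mult _ _ _ _ _ D1 D1 Rmult_comm)
      (is_derive_mult _ _ _ _ _ D2 D2 Rmult_comm)) as D.
    eapply is_derive_ext; [|replace (2 * _) with
      (plus (plus (mult (pt t x) (p t x)) (mult (p t x) (pt t x)))
            (plus (mult (qt t x) (q t x)) (mult (q t x) (qt t x)))); [exact D|]].
    - intros s; reflexivity.
    - unfold plus, mult; simpl; ring. }
  assert (Hex : forall t a b, 0 <= t <= T -> ex_RInt (G t) a b).
  { intros t a b Ht; apply (ex_RInt_continuous (V := R_CompleteNormedModule)).
    intros z _; now apply (clamped_continuous_slice T G). }
  set (N := fun y t => RInt (G t) y (y + 2 * PI)).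
  assert (HPI := PI_RGT_0).
  assert (DN : forall y t, 0 < t < T -> is_derive (N y) t 0).
  { intros y t Ht.
    assert (Hloc : locally t (fun s => 0 < s < T)).
    { apply (locally_interval _ t 0 T); simpl; try lra. intros s H1 H2; simpl in *; lra. }
    assert (Hflux : RInt (fun x => Derive (fun u => G u x) t) y (y + 2 * PI) = 0).
    { rewrite (RInt_ext _ (fun x => Gt t x)).
      2: { intros x _; apply is_derive_unique; now apply DG. }
      apply is_RInt_unique.
      set (J := fun x => 2 * (q t x * px t x - p t x * qx t x)).
      replace 0 with (minus (J (y + 2 * PI)) (J y)).
      - apply (is_RInt_derive (V := R_CompleteNormedModule) J).
        + intros x _; unfold Gt, J; rewrite Heq by lra.
          pose proof (Dpx t x ltac:(lra)) as A1; pose proof (Dqx t x ltac:(lra)) as A2.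
          pose proof (Dpxx t x ltac:(lra)) as A3; pose proof (Dqxx t x ltac:(lra)) as A4.
          auto_derive.
          * repeat split; eexists; eassumption.
          * apply is_derive_unique in A1, A2, A3, A4.
            change (fun x0 => p t x0) with (p t); change (fun x0 => q t x0) with (q t).
            change (fun x0 => px t x0) with (px t); change (fun x0 => qx t x0) with (qx t).
            rewrite A1, A2, A3, A4; ring.
        + intros x _; apply (clamped_continuous_slice T Gt); auto; lra.
      - unfold J; rewrite Pp, Pq by lra.
        rewrite (is_derive_periodic (p t) (px t) (2 * PI)) by (intros; (apply Pp || apply Dpx); lra).
        rewrite (is_derive_periodic (q t) (qx t) (2 * PI)) by (intros; (apply Pq || apply Dqx); lra).
        unfold minus, plus, opp; simpl; ring. }
    rewrite <- Hflux; unfold N.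
    apply (is_derive_RInt_param (fun t x => G t x)).
    - revert Hloc; apply filter_imp; intros s Hs x _; eexists; now apply DG.
    - intros x _.
      apply (continuity_2d_pt_ext_loc (fun u v => Gt (clamp T u) v)).
      + destruct Hloc as [dlt Hd]; exists dlt; intros u v Hu _.
        specialize (Hd u Hu); rewrite clamp_id by lra.
        symmetry; apply is_derive_unique; now apply DG.
      + now apply clamped_continuous_2d.
    - revert Hloc; apply filter_imp; intros s Hs; apply Hex; lra. }
  (* The time derivative exists in the open interval only; uniform continuity of
     the energy density carries the conservation law to both endpoints. *)
  assert (UN : forall y t0, 0 <= t0 <= T -> forall eps : posreal, exists dlt : posreal,
     forall t, 0 <= t <= T -> Rabs (t - t0) < dlt -> Rabs (N y t - N y t0) <= 2 * PI * eps).
  { intros y t0 Ht0 eps.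
    destruct (uniform_continuity_2d (fun u v => G (clamp T u) v) 0 T y (y + 2 * PI)
      (fun u v _ _ => clamped_continuous_2d T G u v CG) eps) as [dlt Hd].
    exists dlt; intros t Ht Htt.
    unfold N.
    pose proof (RInt_correct _ _ _ (Hex t y (y + 2 * PI) Ht)) as I1.
    pose proof (RInt_correct _ _ _ (Hex t0 y (y + 2 * PI) Ht0)) as I2.
    pose proof (is_RInt_minus _ _ _ _ _ _ I1 I2) as I3.
    replace (2 * PI * eps) with ((y + 2 * PI - y) * eps) by ring.
    refine (norm_RInt_le_const (V := R_NormedModule) _ y (y + 2 * PI) _ eps _ _ I3); [lra|].
    intros x Hx.
    specialize (Hd t0 x t x Ht0 Hx Ht Hx Htt).
    rewrite Rminus_diag, Rabs_R0, !clamp_id in Hd by assumption.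
    left; apply Hd, cond_pos. }
  assert (N0 : forall y, N y 0 = 0).
  { intros y; unfold N; rewrite (RInt_ext _ (fun _ => 0)).
    - rewrite RInt_const; apply Rmult_0_r.
    - intros x _; change (p 0 x * p 0 x + q 0 x * q 0 x = 0); rewrite p0, q0; ring. }
  assert (Nconst : forall y s t, 0 < s < T -> 0 < t < T -> N y s = N y t).
  { assert (W : forall y s t, 0 < s -> t < T -> s < t -> N y s = N y t).
    { intros y s t H1 H2 H3; apply (eq_is_derive (V := R_NormedModule) (N y)); auto.
      intros r Hr; apply DN; lra. }
    intros y s t Hs Ht; destruct (Rtotal_order s t) as [H | [-> | H]]; auto.
    - apply W; lra.
    - symmetry; apply W; lra. }
  assert (Nint : forall y t, 0 < t < T -> N y t = 0).
  { intros y t Ht; apply cond_eq; intros eps Heps.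
    assert (Heps' : 0 < eps / (4 * PI)) by (apply Rdiv_lt_0_compat; lra).
    destruct (UN y 0 ltac:(lra) (mkposreal _ Heps')) as [dlt Hd].
    set (s := Rmin (dlt / 2) (T / 2)).
    assert (0 < s) by (apply Rmin_pos; [destruct dlt; simpl|]; lra).
    assert (s <= dlt / 2) by apply Rmin_l; assert (s <= T / 2) by apply Rmin_r.
    rewrite (Nconst y t s) by lra.
    specialize (Hd s ltac:(lra)); rewrite N0 in Hd.
    eapply Rle_lt_trans; [apply Hd; rewrite Rminus_0_r, Rabs_pos_eq by lra; destruct dlt; simpl in *; lra|].
    simpl; replace (2 * PI * (eps / (4 * PI))) with (eps / 2) by (field; lra); lra. }
  assert (Nall : forall y t, 0 <= t <= T -> N y t = 0).
  { intros y t Ht; apply cond_eq; intros eps Heps.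
    assert (Heps' : 0 < eps / (4 * PI)) by (apply Rdiv_lt_0_compat; lra).
    destruct (UN y t Ht (mkposreal _ Heps')) as [dlt Hd].
    assert (Hs : exists s, 0 < s < T /\ Rabs (s - t) < dlt).
    { set (e := Rmin (dlt / 2) (T / 4)).
      assert (0 < e) by (apply Rmin_pos; [destruct dlt; simpl|]; lra).
      assert (e <= dlt / 2) by apply Rmin_l; assert (e <= T / 4) by apply Rmin_r.
      destruct (Rle_lt_dec t (T / 2)).
      - exists (t + e); split; [lra|]; rewrite Rabs_pos_eq; destruct dlt; simpl in *; lra.
      - exists (t - e); split; [lra|]; rewrite Rabs_left1; destruct dlt; simpl in *; lra. }
    destruct Hs as [s [Hs1 Hs2]].
    specialize (Hd s ltac:(lra) Hs2); rewrite Nint, Rminus_0_l, Rabs_Ropp in Hd by exact Hs1.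
    rewrite Rminus_0_r; eapply Rle_lt_trans; [exact Hd|].
    simpl; replace (2 * PI * (eps / (4 * PI))) with (eps / 2) by (field; lra); lra. }
  intros t x Ht.
  assert (HG : G t x = 0).
  { apply (RInt_zero_nonneg (G t) (x - PI) (x - PI + 2 * PI)); [| | lra | apply Nall, Ht].
    - now apply (clamped_continuous_slice T G).
    - intros z; unfold G; nra. }
  unfold G in HG; split; nra.
Qed.

Lemma clamped_continuous_minus T (f g : R -> R -> R) :
  clamped_continuous T f -> clamped_continuous T g ->
  clamped_continuous T (fun t x => f t x - g t x).
Proof.
  intros Hf Hg z; apply (continuous_minus (V := R_NormedModule)); [apply Hf | apply Hg].
Qed.

(** The potential drops out of the energy balance of the difference because it
    is real. *)
Lemma schrodinger_solution_unique V u0 T u v : 0 < T ->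
  schrodinger_solution V u0 T u -> schrodinger_solution V u0 T v ->
  forall t x, 0 <= t <= T -> u t x = v t x.
Proof.
  intros HT [Pu [Iu [Cu [ut [ux [uxx [Cut [_ [Cuxx [Dut Du]]]]]]]]]]
    [Pv [Iv [Cv [vt [vx [vxx [Cvt [_ [Cvxx [Dvt Dv]]]]]]]]]].
  assert (CC : forall f g, continuous_on_strip T f -> continuous_on_strip T g ->
     clamped_continuous T (fun t x => fst (f t x) - fst (g t x)) /\
     clamped_continuous T (fun t x => snd (f t x) - snd (g t x))).
  { intros f g Hf Hg.
    apply continuous_on_strip_clamped in Hf, Hg; try lra.
    split; apply clamped_continuous_minus; intros z.
    - apply (continuous_C_fst (fun p : R * R => f (clamp T (fst p)) (snd p))), Hf.
    - apply (continuous_C_fst (fun p : R * R => g (clamp T (fst p)) (snd p))), Hg.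
    - apply (continuous_C_snd (fun p : R * R => f (clamp T (fst p)) (snd p))), Hf.
    - apply (continuous_C_snd (fun p : R * R => g (clamp T (fst p)) (snd p))), Hg. }
  intros t x Ht.
  assert (H : fst (u t x) - fst (v t x) = 0 /\ snd (u t x) - snd (v t x) = 0).
  { apply (energy_uniqueness T
      (fun t x => fst (u t x) - fst (v t x)) (fun t x => snd (u t x) - snd (v t x))
      (fun t x => fst (ut t x) - fst (vt t x)) (fun t x => snd (ut t x) - snd (vt t x))
      (fun t x => fst (ux t x) - fst (vx t x)) (fun t x => snd (ux t x) - snd (vx t x))
      (fun t x => fst (uxx t x) - fst (vxx t x)) (fun t x => snd (uxx t x) - snd (vxx t x)));
    try apply (CC _ _ Cu Cv); try apply (CC _ _ Cut Cvt); try apply (CC _ _ Cuxx Cvxx); auto.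
    - intros s y Hs; now rewrite (Pu s Hs y), (Pv s Hs y).
    - intros s y Hs; now rewrite (Pu s Hs y), (Pv s Hs y).
    - intros s y Hs; apply (is_derive_minus (V := R_NormedModule));
        [apply (is_derive_C_fst (fun r => u r y)) | apply (is_derive_C_fst (fun r => v r y))]; auto.
    - intros s y Hs; apply (is_derive_minus (V := R_NormedModule));
        [apply (is_derive_C_snd (fun r => u r y)) | apply (is_derive_C_snd (fun r => v r y))]; auto.
    - intros s y Hs; apply (is_derive_minus (V := R_NormedModule));
        [apply is_derive_C_fst, Du | apply is_derive_C_fst, Dv]; auto.
    - intros s y Hs; apply (is_derive_minus (V := R_NormedModule));
        [apply is_derive_C_snd, Du | apply is_derive_C_snd, Dv]; auto.
    - intros s y Hs; apply (is_derive_minus (V := R_NormedModule));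
        [apply is_derive_C_fst, Du | apply is_derive_C_fst, Dv]; auto.
    - intros s y Hs; apply (is_derive_minus (V := R_NormedModule));
        [apply is_derive_C_snd, Du | apply is_derive_C_snd, Dv]; auto.
    - intros s y Hs.
      destruct (Du s y Hs) as [_ [_ Eu]]; destruct (Dv s y Hs) as [_ [_ Ev]].
      pose proof (f_equal fst Eu) as E1; pose proof (f_equal snd Eu) as E2.
      pose proof (f_equal fst Ev) as E3; pose proof (f_equal snd Ev) as E4.
      simpl in E1, E2, E3, E4.
      set (a := fst (u s y) - fst (v s y)); set (b := snd (u s y) - snd (v s y)).
      assert (Ea : fst (ut s y) - fst (vt s y) = - (snd (uxx s y) - snd (vxx s y)) - V s y * b)
        by (unfold b; lra).
      assert (Eb : snd (ut s y) - snd (vt s y) = (fst (uxx s y) - fst (vxx s y)) + V s y * a)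
        by (unfold a; lra).
      rewrite Ea, Eb; ring.
    - intros y; rewrite Iu, Iv; ring.
    - intros y; rewrite Iu, Iv; ring. }
  destruct H as [H1 H2]; apply injective_projections; lra.
Qed.

(** * A travelling potential with an explicit solution *)

(** The expansion in cosines displays the Fourier modes; [potential_eq] gives
    the form that enters the verification of the equation. *)
Definition potential (b q t x : R) : R :=
  - (q ^ 2 * b ^ 2 / 2) + 2 * q ^ 2 * b * cos (q * x + - (q ^ 2 * t))
  + q ^ 2 * b ^ 2 / 2 * cos (2 * (q * x + - (q ^ 2 * t))).

Lemma potential_eq b q t x :
  potential b q t x = q ^ 2 *
    (2 * b * cos (q * x + - (q ^ 2 * t)) - b ^ 2 * sin (q * x + - (q ^ 2 * t)) ^ 2).
Proof.
  unfold potential; rewrite cos_2a_sin; field.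
Qed.

Lemma potential_periodic b (q : Z) t : periodic (potential b (IZR q) t).
Proof.
  intros x; unfold potential.
  replace (IZR q * (x + 2 * PI) + - (IZR q ^ 2 * t))
    with (IZR q * x + - (IZR q ^ 2 * t) + 2 * PI * IZR q) by ring.
  set (y := IZR q * x + - (IZR q ^ 2 * t)).
  replace (2 * (y + 2 * PI * IZR q)) with (2 * y + 2 * PI * IZR (2 * q))
    by (rewrite mult_IZR; ring).
  now rewrite !cos_IZR_period.
Qed.

Lemma potential_real_analytic b q t : real_analytic (E := R_NormedModule) (potential b q t).
Proof.
  apply (real_analytic_ext (fun x =>
    (- (q ^ 2 * b ^ 2 / 2) + 2 * q ^ 2 * b * cos (q * x + - (q ^ 2 * t))
     + q ^ 2 * b ^ 2 / 2 * cos (2 * q * x + - (2 * q ^ 2 * t)))%R : R_NormedModule)).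
  { intros x; unfold potential; do 3 f_equal; ring. }
  apply real_analytic_plus; [apply real_analytic_plus|];
    try apply real_analytic_mult; try apply real_analytic_const; apply real_analytic_cos.
Qed.

(* Joint continuity of expressions in [fst p] and [snd p]. *)
Ltac continuity_tac :=
  lazymatch goal with
  | |- continuous (fun _ => ?c) _ => apply continuous_const
  | |- continuous (fun p => fst p) _ => apply continuous_fst
  | |- continuous (fun p => snd p) _ => apply continuous_snd
  | |- continuous (fun p => @?f p + @?g p) _ =>
      apply (continuous_plus (V := R_NormedModule) f g); continuity_tac
  | |- continuous (fun p => @?f p - @?g p) _ =>
      apply (continuous_minus (V := R_NormedModule) f g); continuity_tac
  | |- continuous (fun p => - @?f p) _ =>
      apply (continuous_opp (V := R_NormedModule) f); continuity_tac
  | |- continuous (fun p => @?f p * @?g p) _ =>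
      apply (continuous_mult (K := R_AbsRing) f g); continuity_tac
  | |- continuous (fun p => cos (@?f p)) _ =>
      apply (continuous_comp f cos); [continuity_tac | apply continuous_cos]
  | |- continuous (fun p => sin (@?f p)) _ =>
      apply (continuous_comp f sin); [continuity_tac | apply continuous_sin]
  | |- continuous (fun p => exp (@?f p)) _ =>
      apply (continuous_comp f exp); [continuity_tac | apply continuous_exp]
  end.

Lemma Derive_n_cos_sum (a0 a1 c1 d1 a2 c2 d2 : R) (n : nat) :
  (forall t, ex_derive_n (fun t => a0 + a1 * cos (c1 * t + d1) + a2 * cos (c2 * t + d2)) n t) /\
  (forall t, Derive_n (fun t => a0 + a1 * cos (c1 * t + d1) + a2 * cos (c2 * t + d2)) n t =
    match n with O => a0 | _ => 0 end
    + a1 * (c1 ^ n * cos (c1 * t + d1 + INR n * (PI / 2)))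
    + a2 * (c2 ^ n * cos (c2 * t + d2 + INR n * (PI / 2)))).
Proof.
  induction n as [|n [_ IH]].
  - split; intros t; simpl; auto.
    replace (c1 * t + d1 + 0 * (PI / 2)) with (c1 * t + d1) by ring.
    replace (c2 * t + d2 + 0 * (PI / 2)) with (c2 * t + d2) by ring.
    now rewrite !Rmult_1_l.
  - assert (E : Derive_n (fun t => a0 + a1 * cos (c1 * t + d1) + a2 * cos (c2 * t + d2)) n =
       fun t => match n with O => a0 | _ => 0 end
        + a1 * (c1 ^ n * cos (c1 * t + d1 + INR n * (PI / 2)))
        + a2 * (c2 ^ n * cos (c2 * t + d2 + INR n * (PI / 2))))
      by (apply functional_extensionality, IH).
    split; intros t; simpl Derive_n; unfold ex_derive_n; rewrite E.
    + auto_derive; auto.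
    + apply is_derive_unique.
      replace (c1 * t + d1 + INR (S n) * (PI / 2)) with (PI / 2 + (c1 * t + d1 + INR n * (PI / 2)))
        by (rewrite S_INR; field).
      replace (c2 * t + d2 + INR (S n) * (PI / 2)) with (PI / 2 + (c2 * t + d2 + INR n * (PI / 2)))
        by (rewrite S_INR; field).
      rewrite <- (Ropp_involutive (cos (PI / 2 + (c1 * t + d1 + _)))), <- sin_cos.
      rewrite <- (Ropp_involutive (cos (PI / 2 + (c2 * t + d2 + _)))), <- sin_cos.
      auto_derive; auto; simpl; ring.
Qed.

Lemma potential_smooth_in_time b q : smooth_in_time (potential b q).
Proof.
  assert (E : forall x, (fun t => potential b q t x) =
    fun t => - (q ^ 2 * b ^ 2 / 2) + 2 * q ^ 2 * b * cos (- q ^ 2 * t + q * x)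
      + q ^ 2 * b ^ 2 / 2 * cos (- 2 * q ^ 2 * t + 2 * q * x)).
  { intros x; apply functional_extensionality; intros t; unfold potential.
    f_equal; [f_equal|]; do 2 f_equal; ring. }
  intros n; split.
  - intros t x; rewrite E; apply Derive_n_cos_sum.
  - intros [t x].
    apply (continuous_ext (fun p : R * R =>
      match n with O => - (q ^ 2 * b ^ 2 / 2) | _ => 0 end
      + 2 * q ^ 2 * b * ((- q ^ 2) ^ n * cos (- q ^ 2 * fst p + q * snd p + INR n * (PI / 2)))
      + q ^ 2 * b ^ 2 / 2 * ((- 2 * q ^ 2) ^ n * cos (- 2 * q ^ 2 * fst p + 2 * q * snd p + INR n * (PI / 2))))).
    { intros p; rewrite E; symmetry; apply Derive_n_cos_sum. }
    continuity_tac.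
Qed.

Lemma RtoC_cos y : RtoC (cos y) = (RtoC (/ 2) * (expi y + expi (- y)))%C.
Proof.
  unfold expi; rewrite cos_neg, sin_neg; apply injective_projections; simpl; field.
Qed.

Lemma potential_coeff b (q : Z) t (j : Z) :
  is_fourier_coeff (fun x => RtoC (potential b (IZR q) t x)) j
   (RtoC (- (IZR q ^ 2 * b ^ 2 / 2)) * (if Z.eq_dec j 0 then 1 else 0) +
    (RtoC (IZR q ^ 2 * b) * expi (- (IZR q ^ 2 * t)) * (if Z.eq_dec j q then 1 else 0) +
    (RtoC (IZR q ^ 2 * b) * expi (IZR q ^ 2 * t) * (if Z.eq_dec j (- q) then 1 else 0) +
    (RtoC (IZR q ^ 2 * b ^ 2 / 4) * expi (- (2 * (IZR q ^ 2 * t))) * (if Z.eq_dec j (2 * q) then 1 else 0) +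
     RtoC (IZR q ^ 2 * b ^ 2 / 4) * expi (2 * (IZR q ^ 2 * t)) * (if Z.eq_dec j (- (2 * q)) then 1 else 0)))))%C.
Proof.
  assert (H0 := is_fourier_coeff_Cmult (RtoC (- (IZR q ^ 2 * b ^ 2 / 2))) _ _ _
    (is_fourier_coeff_const j)).
  assert (H1 := is_fourier_coeff_Cmult (RtoC (IZR q ^ 2 * b) * expi (- (IZR q ^ 2 * t))) _ _ _
    (is_fourier_coeff_expi q j)).
  assert (H2 := is_fourier_coeff_Cmult (RtoC (IZR q ^ 2 * b) * expi (IZR q ^ 2 * t)) _ _ _
    (is_fourier_coeff_expi (- q) j)).
  assert (H3 := is_fourier_coeff_Cmult
    (RtoC (IZR q ^ 2 * b ^ 2 / 4) * expi (- (2 * (IZR q ^ 2 * t)))) _ _ _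
    (is_fourier_coeff_expi (2 * q) j)).
  assert (H4 := is_fourier_coeff_Cmult
    (RtoC (IZR q ^ 2 * b ^ 2 / 4) * expi (2 * (IZR q ^ 2 * t))) _ _ _
    (is_fourier_coeff_expi (- (2 * q)) j)).
  refine (is_fourier_coeff_ext _ _ _ _ _
    (is_fourier_coeff_plus _ _ _ _ _ H0 (is_fourier_coeff_plus _ _ _ _ _ H1
      (is_fourier_coeff_plus _ _ _ _ _ H2 (is_fourier_coeff_plus _ _ _ _ _ H3 H4))))).
  clear H0 H1 H2 H3 H4.
  intros x; cbv beta; unfold potential.
  rewrite !RtoC_plus, !RtoC_mult, !RtoC_cos.
  replace (- (IZR q * x + - (IZR q ^ 2 * t))) with (IZR q ^ 2 * t + IZR (- q) * x)
    by (rewrite opp_IZR; ring).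
  replace (- (2 * (IZR q * x + - (IZR q ^ 2 * t)))) with (2 * (IZR q ^ 2 * t) + IZR (- (2 * q)) * x)
    by (rewrite opp_IZR, mult_IZR; ring).
  replace (2 * (IZR q * x + - (IZR q ^ 2 * t))) with (- (2 * (IZR q ^ 2 * t)) + IZR (2 * q) * x)
    by (rewrite mult_IZR; ring).
  replace (IZR q * x + - (IZR q ^ 2 * t)) with (- (IZR q ^ 2 * t) + IZR q * x) by ring.
  rewrite !expi_add.
  generalize (expi (- (IZR q ^ 2 * t))) (expi (IZR q ^ 2 * t)) (expi (- (2 * (IZR q ^ 2 * t))))
    (expi (2 * (IZR q ^ 2 * t))) (expi (IZR q * x)) (expi (IZR (- q) * x)) (expi (IZR (2 * q) * x))
    (expi (IZR (- (2 * q)) * x)); intros [z1 z2] [z3 z4] [z5 z6] [z7 z8] [y1 y2] [y3 y4] [y5 y6] [y7 y8].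
  apply injective_projections; simpl; field.
Qed.

(** The modes [q] and [- q] have modulus [q^2 b], which the hypothesis bounds; the
    modes [2 q] and [- 2 q] have modulus [q^2 b^2 / 4 <= (q^2 b)^2], which is at
    most [exp (- 2 q^(1/alpha))]. *)
Lemma potential_gevrey alpha b (q : Z) t :
  1 <= alpha -> 0 <= b -> (0 < q)%Z ->
  IZR q ^ 2 * b <= exp (- Rpower (IZR q) (/ alpha)) ->
  Rbar_le (gevrey_seminorm alpha 1 (potential b (IZR q) t)) 1.
Proof.
  intros Ha Hb Hq Hbq.
  set (g := Rpower (IZR q) (/ alpha)) in *.
  assert (Hq1 : 1 <= IZR q) by (apply IZR_le; lia).
  assert (Hg : 0 < g) by apply exp_pos.
  assert (Hia : 0 < / alpha <= 1).
  { split; [apply Rinv_0_lt_compat; lra|].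
    rewrite <- Rinv_1; apply Rinv_le_contravar; lra. }
  assert (Hw2 : Rpower (IZR (2 * q)) (/ alpha) <= 2 * g).
  { rewrite mult_IZR, <- Rpower_mult_distr by lra; fold g.
    apply Rmult_le_compat_r; [lra|].
    rewrite <- (Rpower_1 2) at 2 by lra; apply Rle_Rpower; lra. }
  pose proof (exp_pos (- g)) as He.
  assert (He1 : exp (- g) <= 1) by (rewrite <- exp_0; left; apply exp_increasing; lra).
  set (Q := IZR q ^ 2) in *.
  assert (HQ : 1 <= Q) by (unfold Q; nra).
  assert (Hsq : Q * b ^ 2 <= exp (- g) ^ 2).
  { apply Rle_trans with ((Q * b) ^ 2); [|apply pow_incr; split; [nra | exact Hbq]].
    rewrite Rpow_mult_distr; apply Rmult_le_compat_r; [apply pow2_ge_0 | nra]. }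
  assert (HQb : 0 <= Q * b ^ 2) by (apply Rmult_le_pos; [lra | apply pow2_ge_0]).
  apply (proj1 (Glb_Rbar_correct _)); intros j.
  rewrite Rmult_1_l, (is_fourier_coeff_unique _ _ _ (potential_coeff b q t j)); fold Q.
  assert (Hexp2 : exp (- g) ^ 2 <= exp (- (1) * Rpower (IZR (2 * q)) (/ alpha))).
  { replace (exp (- g) ^ 2) with (exp (- g + - g)) by (rewrite exp_plus; ring).
    destruct (Rle_lt_or_eq_dec (- g + - g) (- (1) * Rpower (IZR (2 * q)) (/ alpha))) as [H | <-];
      [lra | left; now apply exp_increasing | lra]. }
  assert (Hz : forall (a y : R) (z : C), Cmod (RtoC a * expi y * 0 + z) = Cmod z).
  { intros; f_equal; ring. }
  assert (Hl : forall a y, 0 <= a -> Cmod (RtoC a * expi y * 1) = a).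
  { intros a y Hapos; rewrite Cmult_1_r, Cmod_mult, Cmod_expi, Cmod_R, Rabs_pos_eq; lra. }
  assert (Hl0 : forall (a y : R) (z : C), 0 <= a -> z = 0%C -> Cmod (RtoC a * expi y * 1 + z) = a).
  { intros a y z Hapos ->; rewrite Cplus_0_r; auto. }
  unfold gevrey_weight.
  destruct (Z.eq_dec j 0) as [E0 | E0].
  { destruct (Z.eq_dec j q), (Z.eq_dec j (- q)), (Z.eq_dec j (2 * q)), (Z.eq_dec j (- (2 * q))); try lia.
    rewrite Cmult_1_r, !Cmult_0_r, !Cplus_0_r, Cmod_R, Rmult_0_r, exp_0, Rabs_Ropp, Rabs_pos_eq; nra. }
  rewrite Cmult_0_r, Cplus_0_l.
  destruct (Z.eq_dec j q) as [E1 | E1].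
  { destruct (Z.eq_dec j (- q)), (Z.eq_dec j (2 * q)), (Z.eq_dec j (- (2 * q))); try lia.
    rewrite Hl0 by (try nra; ring).
    replace (Z.abs j) with q by lia; fold g.
    replace (- (1) * g) with (- g) by ring; exact Hbq. }
  rewrite Hz.
  destruct (Z.eq_dec j (- q)) as [E2 | E2].
  { destruct (Z.eq_dec j (2 * q)), (Z.eq_dec j (- (2 * q))); try lia.
    rewrite Hl0 by (try nra; ring).
    replace (Z.abs j) with q by lia; fold g.
    replace (- (1) * g) with (- g) by ring; exact Hbq. }
  rewrite Hz.
  destruct (Z.eq_dec j (2 * q)) as [E3 | E3].
  { destruct (Z.eq_dec j (- (2 * q))); try lia.
    rewrite Hl0 by (try lra; ring).
    replace (Z.abs j) with (2 * q)%Z by lia.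
    refine (Rle_trans _ _ _ _ Hexp2); lra. }
  rewrite Hz.
  destruct (Z.eq_dec j (- (2 * q))) as [E4 | E4].
  { rewrite Hl by lra.
    replace (Z.abs j) with (2 * q)%Z by lia.
    refine (Rle_trans _ _ _ _ Hexp2); lra. }
  rewrite Cmult_0_r, Cmod_0; left; apply exp_pos.
Qed.

(** Real and imaginary parts of
    [k exp (b cos theta) (cos (b q^2 t) + i sin (b q^2 t) e^(i theta))] with
    [theta = q x - q^2 t]. *)
Definition solution (k b q t x : R) : C :=
  (k * exp (b * cos (q * x + - (q ^ 2 * t))) *
     (cos (b * q ^ 2 * t) - sin (b * q ^ 2 * t) * sin (q * x + - (q ^ 2 * t))),
   k * exp (b * cos (q * x + - (q ^ 2 * t))) *
     (sin (b * q ^ 2 * t) * cos (q * x + - (q ^ 2 * t)))).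

Lemma solution_periodic k b (q : Z) t : periodic (solution k b (IZR q) t).
Proof.
  intros x; unfold solution.
  replace (IZR q * (x + 2 * PI) + - (IZR q ^ 2 * t))
    with (IZR q * x + - (IZR q ^ 2 * t) + 2 * PI * IZR q) by ring.
  now rewrite cos_IZR_period, sin_IZR_period.
Qed.

Lemma continuous_on_strip_of_continuous T (w : R -> R -> C) :
  (forall p : R * R, continuous (fun p : R * R => w (fst p) (snd p)) p) ->
  continuous_on_strip T w.
Proof.
  intros H t x _.
  intros P HP; apply filter_le_within; exact (H (t, x) P HP).
Qed.

Lemma solution_correct k b (q : Z) T :
  schrodinger_solution (potential b (IZR q)) (solution k b (IZR q) 0) T (solution k b (IZR q)).
Proof.
  split; [intros t _; apply solution_periodic|].
  split; [reflexivity|].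
  split.
  { apply continuous_on_strip_of_continuous; intros [t x].
    apply continuous_C_pair; unfold solution; simpl; continuity_tac. }
  set (Q := IZR q).
  set (th := fun t x => Q * x + - (Q ^ 2 * t)).
  set (E := fun t x => k * exp (b * cos (th t x))).
  set (A := fun t => cos (b * Q ^ 2 * t)).
  set (B := fun t => sin (b * Q ^ 2 * t)).
  set (c := fun t x => cos (th t x)).
  set (s := fun t x => sin (th t x)).
  exists (fun t x =>
    (E t x * (b * Q ^ 2 * s t x * (A t - B t * s t x)
       + (- (b * Q ^ 2 * B t) - b * Q ^ 2 * A t * s t x + B t * (Q ^ 2 * c t x))),
     E t x * (b * Q ^ 2 * s t x * (B t * c t x) + (b * Q ^ 2 * A t * c t x + B t * (Q ^ 2 * s t x))))).
  exists (fun t x =>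
    (Q * E t x * (- (b * s t x * (A t - B t * s t x)) - B t * c t x),
     Q * E t x * (- (b * s t x * (B t * c t x)) - B t * s t x))).
  exists (fun t x =>
    (Q * Q * E t x * (- (b * s t x) * (- (b * s t x * (A t - B t * s t x)) - B t * c t x)
       + (- (b * c t x * (A t - B t * s t x)) + b * s t x * (B t * c t x) + B t * s t x)),
     Q * Q * E t x * (- (b * s t x) * (- (b * s t x * (B t * c t x)) - B t * s t x)
       + (- (b * c t x * (B t * c t x)) + b * s t x * (B t * s t x) - B t * c t x)))).
  unfold E, A, B, c, s, th; clear E A B c s th.
  do 3 (split; [apply continuous_on_strip_of_continuous; intros [t x];
    apply continuous_C_pair; simpl; continuity_tac|]).
  split.
  - intros t x _; unfold solution; fold Q; apply is_derive_C_pair; cbn -[pow];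
      auto_derive; auto; cbn [pow]; ring.
  - intros t x _; unfold solution; fold Q; split; [|split].
    + apply is_derive_C_pair; cbn -[pow]; auto_derive; auto; cbn [pow]; ring.
    + apply is_derive_C_pair; cbn -[pow]; auto_derive; auto; cbn [pow]; ring.
    + rewrite potential_eq.
      pose proof (sin2_cos2 (Q * x + - (Q ^ 2 * t))) as Hsc; unfold Rsqr in Hsc.
      set (cc := cos (Q * x + - (Q ^ 2 * t))) in *.
      set (ss := sin (Q * x + - (Q ^ 2 * t))) in *.
      apply injective_projections; cbn -[pow]; [ring|].
      transitivity (k * exp (b * cc) * Q ^ 2 * b * sin (b * Q ^ 2 * t) * (ss * ss + cc * cc - 1));
        [ring | rewrite Hsc; ring].
Qed.

Lemma solution_real_analytic k b q t :
  real_analytic (E := C_R_NormedModule) (solution k b q t).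
Proof.
  assert (Hc := real_analytic_cos q (- (q ^ 2 * t))).
  assert (Hs : real_analytic (E := R_NormedModule) (fun x => sin (q * x + - (q ^ 2 * t)))).
  { apply (real_analytic_ext (fun x => (-1 * cos (q * x + (PI / 2 + - (q ^ 2 * t))))%R : R_NormedModule)).
    { intros x; rewrite (sin_cos (q * x + - (q ^ 2 * t))).
      replace (PI / 2 + (q * x + - (q ^ 2 * t))) with (q * x + (PI / 2 + - (q ^ 2 * t))) by ring.
      change (-1 * cos (q * x + (PI / 2 + - (q ^ 2 * t))) = - cos (q * x + (PI / 2 + - (q ^ 2 * t)))); ring. }
    apply real_analytic_mult; [apply real_analytic_const | apply real_analytic_cos]. }
  assert (He : real_analytic (E := R_NormedModule) (fun x => k * exp (b * cos (q * x + - (q ^ 2 * t))))).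
  { apply real_analytic_mult; [apply real_analytic_const|].
    apply real_analytic_exp, real_analytic_mult; [apply real_analytic_const | exact Hc]. }
  apply real_analytic_C; simpl.
  - apply real_analytic_mult; [exact He|].
    apply (real_analytic_ext (fun x => (cos (b * q ^ 2 * t) + - sin (b * q ^ 2 * t) * sin (q * x + - (q ^ 2 * t)))%R : R_NormedModule)).
    { intros x; change (cos (b * q ^ 2 * t) + - sin (b * q ^ 2 * t) * sin (q * x + - (q ^ 2 * t)) =
        cos (b * q ^ 2 * t) - sin (b * q ^ 2 * t) * sin (q * x + - (q ^ 2 * t))); ring. }
    apply real_analytic_plus; [apply real_analytic_const|].
    apply real_analytic_mult; [apply real_analytic_const | exact Hs].
  - apply real_analytic_mult; [exact He|].
    apply real_analytic_mult; [apply real_analytic_const | exact Hc].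
Qed.

Lemma solution_initial k b (q : Z) x :
  solution k b (IZR q) 0 x = (RtoC k * exp_cos b q 0 x)%C.
Proof.
  unfold solution, exp_cos; rewrite !Rmult_0_r, Ropp_0, cos_0, sin_0.
  apply injective_projections; simpl; ring.
Qed.

(** After a quarter of the period of the exchange between the resonant modes
    [1] and [e^(i theta)], the coefficient of the former vanishes. *)
Lemma solution_final k b (q : Z) T x : b * IZR q ^ 2 * T = PI / 2 ->
  solution k b (IZR q) T x =
  (RtoC k * Ci * expi (- (IZR q ^ 2 * T)) *
     (expi (IZR q * x) * exp_cos b q (- (IZR q ^ 2 * T)) x))%C.
Proof.
  intros HT; unfold solution; rewrite HT, cos_PI2, sin_PI2.
  transitivity (RtoC k * Ci * expi (IZR q * x + - (IZR q ^ 2 * T)) * exp_cos b q (- (IZR q ^ 2 * T)) x)%C.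
  - unfold exp_cos, expi; apply injective_projections; simpl; ring.
  - rewrite expi_add; ring.
Qed.

(** * Growth of the explicit solution *)

Lemma fourier_coeff_Cmult (a : C) (f : R -> C) (j : Z) : (forall x, continuous f x) ->
  fourier_coeff (fun x => a * f x)%C j = (a * fourier_coeff f j)%C.
Proof.
  intros Hf; now apply is_fourier_coeff_unique, is_fourier_coeff_Cmult, ex_fourier_coeff.
Qed.

Lemma sobolev_term_Cmult s (a : C) (f : R -> C) (j : Z) : (forall x, continuous f x) ->
  sobolev_term s (fun x => a * f x)%C j = Cmod a ^ 2 * sobolev_term s f j.
Proof.
  intros Hf; unfold sobolev_term; rewrite fourier_coeff_Cmult, Cmod_mult by exact Hf; ring.
Qed.

Lemma Hs_norm_Cmult s (a : C) (f : R -> C) : (forall x, continuous f x) ->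
  Hs_norm s (fun x => a * f x)%C = Cmod a * Hs_norm s f.
Proof.
  intros Hf; unfold Hs_norm.
  replace (zseries (sobolev_term s (fun x => a * f x)%C))
    with (Cmod a ^ 2 * zseries (sobolev_term s f)).
  - rewrite sqrt_mult_alt, sqrt_pow2; auto; [apply Cmod_ge_0 | apply pow2_ge_0].
  - unfold zseries.
    rewrite Rmult_plus_distr_l, <- !Series_scal_l.
    f_equal; apply Series_ext; intros n; now rewrite sobolev_term_Cmult.
Qed.

Lemma exp_cos_Hs_norm_bounds s N b (q : Z) :
  s + 1 <= INR N -> 0 <= b <= 1 -> (0 < q)%Z -> b * IZR q ^ S N <= exp (- INR N) ->
  1 <= Hs_norm s (exp_cos b q 0) <= sqrt (8 * (2 ^ N * exp 1 ^ 2)).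
Proof.
  intros Hs Hb Hq HbN.
  assert (Hp : periodic (exp_cos b q 0)).
  { intros x; unfold exp_cos; do 3 f_equal.
    rewrite <- (cos_IZR_period q (IZR q * x + 0)); f_equal; ring. }
  destruct (in_Hs_of_decay s N _ (exp_cos b q 0) Hs Hp (continuous_exp_cos b q 0)
    (exp_cos_decay b q 0 N Hb Hq HbN)) as [[_ [_ H1]] H2].
  unfold Hs_norm; split; [|now apply sqrt_le_1_alt].
  rewrite <- sqrt_1; apply sqrt_le_1_alt.
  refine (Rle_trans _ _ _ _ (sobolev_term_le_zseries _ _ 0 H1)).
  unfold sobolev_term; simpl Z.of_nat.
  rewrite pow_i, Rplus_0_r by lia.
  unfold Rpower; rewrite ln_1, Rmult_0_r, exp_0, Rmult_1_l.
  rewrite <- (pow1 2); apply pow_incr; split; [lra|].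
  apply exp_cos_coeff_0_ge; lia.
Qed.

(** At time [T] the mode [q] of the solution is, up to a phase, [k] times the zero
    mode of [exp (b cos (q x + phi))], hence at least [k]; this mode alone gives
    the lower bound. *)
Lemma solution_growth s N b (q : nat) T :
  0 < s -> s + 1 <= INR N -> 0 <= b <= 1 -> (0 < q)%nat ->
  b * INR q ^ S N <= exp (- INR N) -> b * INR q ^ 2 * T = PI / 2 ->
  let k := / Hs_norm s (exp_cos b (Z.of_nat q) 0) in
  let u := solution k b (INR q) in
  (in_Hs s (u 0) /\ Hs_norm s (u 0) = 1) /\
  in_Hs s (u T) /\ Rpower (INR q) s / sqrt (8 * (2 ^ N * exp 1 ^ 2)) <= Hs_norm s (u T).
Proof.
  intros Hs0 Hs Hb Hq HbN HT.
  rewrite (INR_IZR_INZ q) in HbN, HT |- *; intros k u.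
  set (qz := Z.of_nat q) in *.
  assert (Hqz : (0 < qz)%Z) by (unfold qz; lia).
  assert (Hq1 : 1 <= IZR qz) by (apply IZR_le; lia).
  destruct (exp_cos_Hs_norm_bounds s N b qz Hs Hb Hqz HbN) as [Hn1 Hn2].
  set (n0 := Hs_norm s (exp_cos b qz 0)) in *.
  assert (Hk : 0 < k) by (apply Rinv_0_lt_compat; lra).
  assert (E0 : u 0 = (fun x => RtoC k * exp_cos b qz 0 x)%C)
    by (apply functional_extensionality; intros x; apply solution_initial).
  assert (ET : u T = (fun x => RtoC k * Ci * expi (- (IZR qz ^ 2 * T)) *
       (expi (IZR qz * x) * exp_cos b qz (- (IZR qz ^ 2 * T)) x))%C)
    by (apply functional_extensionality; intros x; now apply solution_final).
  set (phi := - (IZR qz ^ 2 * T)) in *.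
  set (z := (RtoC k * Ci * expi phi)%C) in *.
  assert (Hz : Cmod z = k).
  { unfold z; rewrite !Cmod_mult, Cmod_expi, Cmod_R, Rabs_pos_eq by lra.
    unfold Cmod, Ci; simpl; rewrite !Rmult_0_l, Rplus_0_l, !Rmult_1_l, sqrt_1; ring. }
  set (h := fun x => (expi (IZR qz * x) * exp_cos b qz phi x)%C) in *.
  assert (Hh : forall x, continuous h x).
  { intros x; apply continuous_Cmult; [|apply continuous_exp_cos].
    apply continuous_expi, (continuous_mult (K := R_AbsRing)); [apply continuous_const | apply continuous_id]. }
  assert (Hscal : forall (a : C) f (x : R), continuous f x -> continuous (fun x => a * f x)%C x).
  { intros a f x Hf; apply continuous_Cmult; [apply continuous_const | exact Hf]. }
  assert (Hsq : forall a m K : R, m <= K -> a ^ 2 * m <= a ^ 2 * K)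
    by (intros a m K HmK; apply Rmult_le_compat_l; [apply pow2_ge_0 | exact HmK]).
  split; [split|].
  - apply (in_Hs_of_decay s N (k ^ 2 * (2 ^ N * exp 1 ^ 2))); [exact Hs | | |].
    + apply solution_periodic.
    + rewrite E0; intros x; apply Hscal, continuous_exp_cos.
    + intros j; rewrite E0, fourier_coeff_Cmult, Cmod_mult, Cmod_R, Rabs_pos_eq by
        (try lra; apply continuous_exp_cos).
      rewrite Rpow_mult_distr, <- Rmult_assoc, (Rmult_comm _ (k ^ 2)), Rmult_assoc.
      apply Hsq; now apply exp_cos_decay.
  - rewrite E0, Hs_norm_Cmult by (apply continuous_exp_cos).
    rewrite Cmod_R, Rabs_pos_eq by lra; unfold k; fold n0; apply Rinv_l; lra.
  - destruct (in_Hs_of_decay s N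
      (k ^ 2 * ((2 * (1 + IZR qz ^ 2)) ^ N * (2 ^ N * exp 1 ^ 2))) (u T) Hs) as [HuT _].
    + apply solution_periodic.
    + rewrite ET; intros x; apply Hscal, Hh.
    + intros j; rewrite ET, fourier_coeff_Cmult, Cmod_mult, Hz by exact Hh.
      rewrite Rpow_mult_distr, <- Rmult_assoc, (Rmult_comm _ (k ^ 2)), Rmult_assoc.
      apply Hsq; now apply exp_cos_shift_decay.
    + split; [exact HuT|].
      set (M := sqrt (8 * (2 ^ N * exp 1 ^ 2))) in *.
      assert (HkM : / M <= k) by (apply Rinv_le_contravar; lra).
      assert (HM : 0 < / M) by (apply Rinv_0_lt_compat; lra).
      pose proof (exp_pos (s * ln (IZR qz))) as HRp; fold (Rpower (IZR qz) s) in HRp.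
      unfold Hs_norm.
      rewrite <- (sqrt_pow2 (Rpower (IZR qz) s / M))
        by (apply Rmult_le_pos; lra).
      apply sqrt_le_1_alt.
      refine (Rle_trans _ _ _ _ (sobolev_term_le_zseries s (u T) q (proj2 (proj2 HuT)))).
      fold qz; rewrite ET, sobolev_term_Cmult, Hz by exact Hh.
      unfold sobolev_term, h.
      assert (Hc : is_fourier_coeff (fun x => (expi (IZR qz * x) * exp_cos b qz phi x)%C) qz
          (fourier_coeff (exp_cos b qz phi) 0)).
      { apply is_fourier_coeff_shift; rewrite Z.sub_diag.
        apply ex_fourier_coeff, continuous_exp_cos. }
      rewrite (is_fourier_coeff_unique _ _ _ Hc).
      assert (H1 : 1 <= Cmod (fourier_coeff (exp_cos b qz phi) 0)) by (apply exp_cos_coeff_0_ge; lia).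
      assert (H2 : Rpower (IZR qz) s ^ 2 <= Rpower (1 + IZR qz ^ 2) s).
      { replace (Rpower (IZR qz) s ^ 2) with (Rpower (IZR qz * IZR qz) s)
          by (rewrite <- Rpower_mult_distr by lra; ring).
        apply Rle_Rpower_l; [lra|]; nra. }
      unfold Rdiv; rewrite Rpow_mult_distr, Rmult_comm.
      apply Rmult_le_compat; try (apply pow2_ge_0); [apply pow_incr; lra|].
      rewrite <- (Rmult_1_r (_ ^ 2)).
      apply Rmult_le_compat; [apply pow2_ge_0 | lra | exact H2 |].
      rewrite <- (pow1 2); apply pow_incr; lra.
Qed.

(** The factor [exp (- q^(1/alpha))] is the Gevrey bound at frequency [q]; the
    remaining factors are those required by [exp_cos_decay], and they contribute
    only [O(1 + ln q)] to the logarithm of the transfer time. *)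
Definition coupling (alpha : R) (N q : nat) : R :=
  exp (- Rpower (INR q) (/ alpha)) * exp (- INR N) * / INR q ^ S N.

Definition transfer_time (alpha : R) (N q : nat) : R :=
  PI / (2 * (coupling alpha N q * INR q ^ 2)).

Lemma coupling_bounds alpha N q : (0 < q)%nat ->
  0 < coupling alpha N q <= 1 /\
  coupling alpha N q * INR q ^ S N <= exp (- INR N) /\
  ((0 < N)%nat -> INR q ^ 2 * coupling alpha N q <= exp (- Rpower (INR q) (/ alpha))).
Proof.
  intros Hq; unfold coupling.
  set (g := Rpower (INR q) (/ alpha)).
  assert (Hg : 0 < g) by apply exp_pos.
  pose proof (exp_pos (- g)) as He; pose proof (exp_pos (- INR N)) as HeN.
  assert (exp (- g) <= 1) by (rewrite <- exp_0; left; apply exp_increasing; lra).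
  assert (exp (- INR N) <= 1).
  { pose proof (pos_INR N) as HN; rewrite <- exp_0.
    destruct HN as [HN | <-]; [left; apply exp_increasing; lra | rewrite Ropp_0; lra]. }
  assert (Hq1 : 1 <= INR q) by (apply (le_INR 1); lia).
  assert (HqN : 1 <= INR q ^ S N) by (now apply pow_R1_Rle).
  assert (Hi : 0 < / INR q ^ S N <= 1).
  { split; [apply Rinv_0_lt_compat; lra|].
    rewrite <- Rinv_1; apply Rinv_le_contravar; lra. }
  set (a := exp (- g)) in *; set (c := exp (- INR N)) in *.
  assert (Hac : 0 < a * c <= 1) by nra.
  split; [|split].
  - nra.
  - rewrite Rmult_assoc, Rinv_l by lra; nra.
  - intros HN.
    assert (Hq2 : INR q ^ 2 <= INR q ^ S N) by (apply Rle_pow; [lra | lia]).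
    apply Rle_trans with (INR q ^ S N * (a * c * / INR q ^ S N)).
    + apply Rmult_le_compat_r; [nra | exact Hq2].
    + replace (INR q ^ S N * (a * c * / INR q ^ S N)) with (a * c) by (field; lra); nra.
Qed.

Lemma transfer_time_eq alpha N q : (0 < q)%nat ->
  transfer_time alpha N q =
  PI / 2 * exp (Rpower (INR q) (/ alpha)) * exp (INR N) * (INR q ^ S N / INR q ^ 2).
Proof.
  intros Hq; unfold transfer_time, coupling.
  assert (0 < INR q) by (now apply lt_0_INR).
  rewrite !exp_Ropp; field.
  repeat split; try apply pow_nonzero; try (apply Rgt_not_eq, exp_pos); lra.
Qed.

Lemma transfer_time_ge alpha N q : (2 <= N)%nat -> (0 < q)%nat ->
  PI / 2 * INR q <= transfer_time alpha N q.
Proof.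
  intros HN Hq; rewrite transfer_time_eq by exact Hq.
  pose proof PI_RGT_0.
  assert (Hq1 : 1 <= INR q) by (apply (le_INR 1); lia).
  assert (Hqq : INR q <= INR q ^ S N / INR q ^ 2).
  { replace (INR q) with (INR q ^ 3 / INR q ^ 2) at 1 by (field; lra).
    apply Rmult_le_compat_r; [left; apply Rinv_0_lt_compat, pow_lt; lra|].
    apply Rle_pow; [lra | lia]. }
  assert (H1 : 1 <= exp (Rpower (INR q) (/ alpha))).
  { pose proof (exp_ineq1_le (Rpower (INR q) (/ alpha))).
    pose proof (exp_pos (/ alpha * ln (INR q))); unfold Rpower in *; lra. }
  assert (H2 : 1 <= exp (INR N)).
  { pose proof (exp_ineq1_le (INR N)); pose proof (pos_INR N); lra. }
  rewrite !Rmult_assoc; apply Rmult_le_compat_l; [lra|].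
  assert (1 <= exp (Rpower (INR q) (/ alpha)) * exp (INR N)) by nra.
  rewrite <- Rmult_assoc; nra.
Qed.

(** The powers of [q] in the transfer time are harmless because
    [ln q = alpha ln (q^(1/alpha)) <= alpha q^(1/alpha)]. *)
Lemma ln_transfer_time_le alpha N q : 1 <= alpha -> (0 < q)%nat ->
  ln (transfer_time alpha N q) <=
  (2 + INR N + INR (S N) * alpha) * Rpower (INR q) (/ alpha).
Proof.
  intros Ha Hq; rewrite transfer_time_eq by exact Hq.
  set (g := Rpower (INR q) (/ alpha)).
  assert (Hq1 : 1 <= INR q) by (apply (le_INR 1); lia).
  assert (Hia : 0 < / alpha) by (apply Rinv_0_lt_compat; lra).
  assert (Hlnq : 0 <= ln (INR q)) by (rewrite <- ln_1; apply Rcomplements.ln_le; lra).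
  assert (Hg1 : 1 <= g).
  { unfold g, Rpower.
    pose proof (exp_ineq1_le (/ alpha * ln (INR q))); nra. }
  assert (Hlng : ln (INR q) <= alpha * g).
  { replace (ln (INR q)) with (alpha * ln g)
      by (unfold g; rewrite ln_Rpower; field; lra).
    apply Rmult_le_compat_l; [lra|].
    pose proof (exp_ineq1_le (ln g)) as H; rewrite exp_ln in H by lra; lra. }
  pose proof PI_RGT_0 as HPI.
  assert (HPI1 : PI / 2 <= exp 1) by (pose proof PI_4; pose proof (exp_ineq1_le 1); lra).
  assert (Hqq : INR q ^ S N / INR q ^ 2 <= INR q ^ S N).
  { assert (0 < INR q ^ S N) by (apply pow_lt; lra).
    assert (/ INR q ^ 2 <= 1).
    { rewrite <- Rinv_1; apply Rinv_le_contravar; [lra|]; apply pow_R1_Rle; lra. }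
    unfold Rdiv; nra. }
  apply Rle_trans with (ln (exp 1 * exp g * exp (INR N) * exp (INR (S N) * ln (INR q)))).
  - assert (Hqe : exp (INR (S N) * ln (INR q)) = INR q ^ S N) by (apply (Rpower_pow (S N)); lra).
    rewrite Hqe.
    pose proof (exp_pos g); pose proof (exp_pos (INR N)).
    assert (0 < INR q ^ S N / INR q ^ 2) by (apply Rdiv_lt_0_compat; apply pow_lt; lra).
    apply Rcomplements.ln_le.
    + repeat (apply Rmult_lt_0_compat; [|lra || assumption]); lra.
    + apply Rmult_le_compat; [| lra | | exact Hqq].
      * left; repeat (apply Rmult_lt_0_compat; [|lra || assumption]); lra.
      * apply Rmult_le_compat_r; [lra|]; apply Rmult_le_compat_r; lra.
  - rewrite <- !exp_plus, ln_exp.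
    pose proof (pos_INR N) as HN.
    assert (INR N <= INR N * g) by nra.
    assert (INR (S N) * ln (INR q) <= INR (S N) * (alpha * g))
      by (apply Rmult_le_compat_l; [apply pos_INR | exact Hlng]).
    nra.
Qed.

Theorem theorem1p3 (alpha : R) (halpha : 1 <= alpha) :
  exists B Calpha : R, 0 < B /\ 0 < Calpha /\
  forall s : R, 0 < s ->
  exists Calphas : R, 0 < Calphas /\
  exists (q0 : nat) (V : nat -> R -> R -> R) (u0 : nat -> R -> C)
         (T : nat -> R),
    (0 < q0)%nat /\
    is_lim_seq T p_infty /\
    forall q : nat, (q0 <= q)%nat ->
      1 < T q /\
      (forall t : R, periodic (V q t)) /\
      smooth_in_time (V q) /\
      (forall t : R, real_analytic (E := R_NormedModule) (V q t)) /\
      (forall t : R, 0 <= t <= T q ->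
         Rbar_le (gevrey_seminorm alpha B (V q t)) Calpha) /\
      in_Hs s (u0 q) /\ Hs_norm s (u0 q) = 1 /\
      (exists u : R -> R -> C, schrodinger_solution (V q) (u0 q) (T q) u) /\
      (forall u : R -> R -> C, schrodinger_solution (V q) (u0 q) (T q) u ->
         (forall t : R, 0 <= t <= T q ->
            real_analytic (E := C_R_NormedModule) (u t)) /\
         in_Hs s (u (T q)) /\
         Calphas * Rpower (ln (T q)) (s * alpha) <= Hs_norm s (u (T q))).
Proof.
  exists 1, 1; split; [lra|]; split; [lra|]; intros s Hs.
  (* [N] is the number of powers of the frequency that the decay has to beat. *)
  destruct (INR_unbounded (s + 1)) as [N HN].
  assert (HN2 : (2 <= N)%nat).
  { destruct N as [|[|N]]; [simpl in HN; lra | simpl in HN; lra | lia]. }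
  set (M := sqrt (8 * (2 ^ N * exp 1 ^ 2))).
  set (L := 2 + INR N + INR (S N) * alpha).
  assert (HM : 0 < M).
  { pose proof (exp_pos 1).
    apply sqrt_lt_R0, Rmult_lt_0_compat; [lra|].
    apply Rmult_lt_0_compat; apply pow_lt; lra. }
  assert (HL : 0 < L).
  { unfold L; pose proof (pos_INR N); pose proof (pos_INR (S N)); nra. }
  assert (HLp : 0 < Rpower L (s * alpha)) by apply exp_pos.
  set (b := coupling alpha N); set (T := transfer_time alpha N).
  set (k := fun q => / Hs_norm s (exp_cos (b q) (Z.of_nat q) 0)).
  exists (/ (M * Rpower L (s * alpha))).
  split; [apply Rinv_0_lt_compat, Rmult_lt_0_compat; assumption|].
  exists 1%nat, (fun q => potential (b q) (INR q)), (fun q => solution (k q) (b q) (INR q) 0), T.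
  pose proof PI2_1 as HPI.
  split; [lia|]; split.
  { apply (is_lim_seq_le_p_loc INR); [|apply is_lim_seq_INR].
    exists 1%nat; intros q Hq.
    pose proof (transfer_time_ge alpha N q HN2 ltac:(lia)).
    pose proof (pos_INR q); unfold T; nra. }
  intros q Hq1.
  assert (Hq : (0 < q)%nat) by lia.
  assert (Hqr : 1 <= INR q) by (now apply (le_INR 1)).
  destruct (coupling_bounds alpha N q Hq) as [Hb [HbN HbV]]; fold (b q) in Hb, HbN, HbV.
  specialize (HbV ltac:(lia)).
  assert (HT1 : 1 < T q).
  { pose proof (transfer_time_ge alpha N q HN2 Hq); unfold T; nra. }
  assert (HTq : b q * INR q ^ 2 * T q = PI / 2).
  { unfold T, transfer_time; fold (b q); field; split; lra. }
  destruct (solution_growth s N (b q) q (T q) Hs ltac:(lra) ltac:(lra) Hq HbN HTq)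
    as [[Hin0 Hn0] [HinT HnT]].
  fold (k q) in Hin0, Hn0, HinT, HnT.
  assert (Hsol : schrodinger_solution (potential (b q) (INR q))
    (solution (k q) (b q) (INR q) 0) (T q) (solution (k q) (b q) (INR q)))
    by (rewrite INR_IZR_INZ; apply solution_correct).
  split; [exact HT1|].
  split; [intros t; rewrite INR_IZR_INZ; apply potential_periodic|].
  split; [apply potential_smooth_in_time|].
  split; [intros t; apply potential_real_analytic|].
  split.
  { intros t _; rewrite INR_IZR_INZ in HbV |- *; apply potential_gevrey; auto; [lra | lia]. }
  split; [exact Hin0|]; split; [exact Hn0|]; split; [eexists; exact Hsol|].
  intros u Hu.
  assert (E : forall t, 0 <= t <= T q -> u t = solution (k q) (b q) (INR q) t).
  { intros t Ht; apply functional_extensionality; intros x.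
    refine (schrodinger_solution_unique _ _ _ _ _ _ Hu Hsol t x Ht); lra. }
  split; [intros t Ht; rewrite E by exact Ht; apply solution_real_analytic|].
  rewrite E by lra.
  split; [exact HinT|].
  refine (Rle_trans _ _ _ _ HnT); fold M.
  assert (Hln : 0 < ln (T q)) by (rewrite <- ln_1; apply ln_increasing; lra).
  assert (Hle : Rpower (ln (T q)) (s * alpha) <= Rpower L (s * alpha) * Rpower (INR q) s).
  { replace (Rpower (INR q) s) with (Rpower (Rpower (INR q) (/ alpha)) (s * alpha))
      by (rewrite Rpower_mult; f_equal; field; lra).
    rewrite Rpower_mult_distr by (try exact HL; apply exp_pos).
    apply Rle_Rpower_l; [nra|]; split; [exact Hln|].
    now apply ln_transfer_time_le. }
  rewrite Rinv_mult; unfold Rdiv.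
  apply Rle_trans with (/ M * / Rpower L (s * alpha) * (Rpower L (s * alpha) * Rpower (INR q) s)).
  - apply Rmult_le_compat_l; [|exact Hle].
    left; apply Rmult_lt_0_compat; now apply Rinv_0_lt_compat.
  - right; field; split; lra.
Qed.
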